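(* Let $\Phi$ be a homogeneous Poisson point process with intensity $\lambda>0$ on $\mathbb{R}^d$. In the approximation $1-\exp(-\lambda\kappa_d\rho_dr^d)$ of the cumulative distribution function of the distance $R_o$ from the nucleus to a uniformly random point in the typical cell $V_o$, with the correction factor $\rho_d$ defined in the context, $\rho_d$ is equal to the ratio of the mean volumes of the 0-cell $\tilde V_o$ and the typical cell $V_o$, i.e., $$\rho_d=\frac{\mathbb{E}[\upsilon_d(\tilde V_o)]}{\mathbb{E}[\upsilon_d(V_o)]}.$$
   Context: For $\mathbf{x}\in\Phi$, $V_{\mathbf{x}}=\{\mathbf{y}\in\mathbb{R}^d : \|\mathbf{y}-\mathbf{x}\|\le\|\mathbf{x}'-\mathbf{y}\|\ \ \forall\mathbf{x}'\in\Phi\}$; the 0-cell $\tilde V_o$ is the (a.s. unique) cell $V_{\mathbf{x}}$ containing the origin $o$. The typical cell is $V_o=\{\mathbf{y}\in\mathbb{R}^d : \|\mathbf{y}\|\le\|\mathbf{x}-\mathbf{y}\|\ \ \forall\mathbf{x}\in\Phi\}$, with nucleus $o$; conditionally on $\Phi$, $R_o=\|\mathbf{Y}\|$ with $\mathbf{Y}$ uniform on $V_o$. $\upsilon_d$ is Lebesgue measure on $\mathbb{R}^d$, $\mathcal{B}_r(o)$ is the ball of radius $r$ centered at $o$, $\kappa_d=\pi^{d/2}/\Gamma(\frac d2+1)$. Correction factor: the exact CDF is $F_{R_o}(r)=\mathbb{E}[Z_1/Z_2]$ with $Z_1=\upsilon_d(\mathcal{B}_r(o)\cap V_o)$, $Z_2=\upsilon_d(V_o)$;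 its second-order Taylor approximation around the means $\bar z_i=\mathbb{E}[Z_i]$ is $G(r)=\frac{\bar z_1}{\bar z_2}-\frac{\mathrm{Cov}[Z_1,Z_2]}{\bar z_2^2}+\frac{\bar z_1}{\bar z_2^3}\mathrm{Var}[Z_2]$, and $\rho_d$ is the number for which the $d$-th derivatives at $r=0$ (from the right) of $1-\exp(-\rho_d\lambda\kappa_dr^d)$ and of $G(r)$ agree. Its value is $\rho_d=1+\frac{\mathrm{Var}[\upsilon_d(V_o)]}{\mathbb{E}[\upsilon_d(V_o)]^2}$. *)

(* Defs.v *)
From HB Require Import structures.
From mathcomp Require Import all_boot all_order all_algebra.
From mathcomp Require Import all_classical all_reals all_analysis.

Set Implicit Arguments.
Unset Strict Implicit.
Unset Printing Implicit Defensive.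

Import Order.TTheory GRing.Theory Num.Theory.
Import numFieldNormedType.Exports.

Local Open Scope classical_set_scope.
Local Open Scope ring_scope.
Local Open Scope card_scope.

(* R^d, with the product (that is, Borel) sigma-algebra that the library puts
   on tuples. *)
Notation Rvec R d := (d.-tuple (measurableTypeR R)).

Section lebesgue_product.
Context {R : realType} (n : nat).
Variable mu : {sigma_finite_measure set (Rvec R n) -> \bar R}.

Definition tcons (p : measurableTypeR R * Rvec R n) : Rvec R n.+1 :=
  [tuple of p.1 :: p.2].

Lemma measurable_tcons : measurable_fun [set: measurableTypeR R * Rvec R n] tcons.
Proof.
exact: (@measurable_cons _ _ _ (measurableTypeR R) fst n snd
  measurable_fst measurable_snd).
Qed.

Definition lebesgue_cons : set (Rvec R n.+1) -> \bar R :=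
  pushforward (@lebesgue_measure R \x mu)%E tcons.

Let lebesgue_cons0 : lebesgue_cons set0 = 0%E.
Proof. by rewrite /lebesgue_cons /pushforward preimage_set0 measure0. Qed.

Let lebesgue_cons_ge0 A : (0 <= lebesgue_cons A)%E.
Proof. by rewrite /lebesgue_cons /pushforward; exact: measure_ge0. Qed.

Let lebesgue_cons_sigma_additive : semi_sigma_additive lebesgue_cons.
Proof.
move=> F mF tF mUF; rewrite /lebesgue_cons /pushforward preimage_bigcup.
apply: measure_semi_sigma_additive.
- by move=> k; rewrite -[X in measurable X]setTI; exact: measurable_tcons.
- apply/trivIsetP => /= i j _ _ ij; rewrite -preimage_setI.
  by move/trivIsetP : tF => /(_ _ _ _ _ ij) ->//; rewrite preimage_set0.
- by rewrite -preimage_bigcup -[X in measurable X]setTI; exact: measurable_tcons.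
Qed.

HB.instance Definition _ := isMeasure.Build _ _ _ lebesgue_cons
  lebesgue_cons0 lebesgue_cons_ge0 lebesgue_cons_sigma_additive.

Let lebesgue_cons_sigma_finite : sigma_finite setT lebesgue_cons.
Proof.
have /sigma_finiteP[A [TA ndA Afin]] := sigma_finiteT (@lebesgue_measure R).
have /sigma_finiteP[B [TB ndB Bfin]] := sigma_finiteT mu.
pose u (v : Rvec R n.+1) : measurableTypeR R * Rvec R n :=
  (thead v, [tuple of behead v]).
have uK (v : Rvec R n.+1) : tcons (u v) = v by rewrite [RHS]tuple_eta.
have tK p : u (tcons p) = p.
  by case: p => x t; rewrite /u /tcons theadE; congr pair; apply: val_inj.
have meas_u : measurable_fun setT u.
  apply/measurable_fun_pairP; split => /=.
    exact: (@measurable_tnth _ (measurableTypeR R) n.+1 ord0).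
  exact: measurable_behead.
exists (fun k => u @^-1` (A k `*` B k)).
  rewrite -preimage_bigcup -(preimage_setT u); congr (_ @^-1` _).
  rewrite -setXTT TA TB predeqE => -[x y]; split.
    move=> [/= [i _ Aix] [j _ Bjy]]; exists (maxn i j) => //; split.
    - by move: x Aix; exact/subsetPset/ndA/leq_maxl.
    - by move: y Bjy; exact/subsetPset/ndB/leq_maxr.
  by move=> [i _ []/= ? ?]; split; exists i.
move=> k; have [mAk Ak] := Afin k; have [mBk Bk] := Bfin k; split.
  by rewrite -[X in measurable X]setTI; apply: meas_u => //; exact: measurableX.
rewrite /lebesgue_cons /pushforward -comp_preimage.
rewrite (_ : u \o tcons = id) ?preimage_id; last exact/funext.
by rewrite product_measure1E// lte_mul_pinfty// ge0_fin_numE.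
Qed.

HB.instance Definition _ := Measure_isSigmaFinite.Build _ _ _ lebesgue_cons
  lebesgue_cons_sigma_finite.

End lebesgue_product.

(* Lebesgue measure on R^d, as the d-fold product of the one-dimensional one. *)
Fixpoint lebesgue_measure_vec (R : realType) (d : nat) :
    {sigma_finite_measure set (Rvec R d) -> \bar R} :=
  match d with
  | 0 => \d_[tuple]
  | n.+1 => lebesgue_cons (lebesgue_measure_vec R n)
  end.

Section voronoi.
Context {R : realType} {d : nat}.
Implicit Types (x y : Rvec R d) (S : set (Rvec R d)).

Definition origin : Rvec R d := [tuple (0 : R) | _ < d].

Definition edist x y : R :=
  Num.sqrt (\sum_(i < d) ((tnth x i : R) - tnth y i) ^+ 2).

Definition eball x (r : R) : set (Rvec R d) := [set y | edist y x <= r].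

Definition voronoi_cell S x : set (Rvec R d) :=
  [set y | forall x', S x' -> edist y x <= edist x' y].

(* Cell of the added nucleus o; [S] itself need not contain o. *)
Definition typical_cell S : set (Rvec R d) := voronoi_cell S origin.

(* The cell of a nucleus chosen among those whose cell contains o; for a
   Poisson process that nucleus is almost surely unique. *)
Definition zero_cell S : set (Rvec R d) :=
  voronoi_cell S (get [set x | S x /\ voronoi_cell S x origin]).

End voronoi.

(* A simple point process is a random locally finite subset of R^d.  Counts are
   only constrained on bounded Borel sets, where they are finite.
   [A #= `I_k] says that the set A has exactly k elements. The second argument
   of [poisson_prob] is a dummy; at rate 0 that measure is the Dirac mass at 0,
   unlike [poisson_pmf]. *)
Record poisson_process {disp : measure_display} {T : measurableType disp}
    {R : realType} {d : nat} (P : probability T R) (lam : R)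
    (Phi : T -> set (Rvec R d)) : Prop := PoissonProcess {
  poisson_locally_finite : forall w (r : R),
    finite_set (Phi w `&` eball origin r) ;
  poisson_measurable_count : forall (B : set (Rvec R d)) (r : R) (k : nat),
    measurable B -> B `<=` eball origin r ->
    measurable [set w | Phi w `&` B #= `I_k] ;
  poisson_count : forall (B : set (Rvec R d)) (r : R) (k : nat),
    measurable B -> B `<=` eball origin r ->
    P [set w | Phi w `&` B #= `I_k] =
    poisson_prob (lam * fine (lebesgue_measure_vec R d B)) 0%N [set k] ;
  poisson_independent : forall (n : nat) (B : 'I_n -> set (Rvec R d)) (r : R)
      (k : 'I_n -> nat),
    (forall i, measurable (B i)) -> (forall i, B i `<=` eball origin r) ->
    trivIset setT B ->
    P (\bigcap_i [set w | Phi w `&` B i #= `I_(k i)]) =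
    (\prod_(i < n) P [set w | Phi w `&` B i #= `I_(k i)])%E
}.

Definition Gamma_fun {R : realType} (x : R) : R :=
  (\int[@lebesgue_measure R]_(t in `]0, +oo[) (t `^ (x - 1) * expR (- t)))%R.

(* Volume of the unit ball of R^d. *)
Definition kappa (R : realType) (d : nat) : R :=
  pi `^ (d%:R / 2) / Gamma_fun (d%:R / 2 + 1).

(* [is_derivn_within A n f x l]: f, seen as a function on A only, has an n-th
   derivative at x, equal to l. For A = [0, +oo[ and x = 0 all the derivatives
   at x are derivatives from the right. *)
Fixpoint is_derivn_within {R : realType} (A : set R) (n : nat) (f : R -> R)
    (x l : R) : Prop :=
  match n with
  | 0 => f x = l
  | m.+1 => exists g : R -> R,
      (\forall y \near within A (nbhs x), is_derivn_within A m f y (g y)) /\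
      (g y - g x) / (y - x) @[y --> within A (dnbhs x)] --> l
  end.

Section correction_factor.
Context {disp : measure_display} {T : measurableType disp} {R : realType}.
Context {d : nat}.
Variables (P : probability T R) (lam : R) (Phi : T -> set (Rvec R d)).

(* [fine] is harmless: the typical cell is almost surely bounded. *)
Definition Z1 (r : R) (w : T) : R :=
  fine (lebesgue_measure_vec R d (eball origin r `&` typical_cell (Phi w))).

Definition Z2 (w : T) : R :=
  fine (lebesgue_measure_vec R d (typical_cell (Phi w))).

(* Second-order Taylor approximation of E[Z1/Z2], which is the distribution
   function of R_o, around the means of Z1 and Z2. *)
Definition G (r : R) : R :=
  let z1 := fine 'E_P[Z1 r] in
  let z2 := fine 'E_P[Z2] in
  z1 / z2 - fine (covariance P (Z1 r) Z2) / z2 ^+ 2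
  + z1 / z2 ^+ 3 * fine 'V_P[Z2].

Definition is_correction_factor (rho : R) : Prop :=
  exists l : R,
    is_derivn_within `[0, +oo[ d
      (fun r => 1 - expR (- (rho * lam * kappa R d * r ^+ d))) 0 l /\
    is_derivn_within `[0, +oo[ d G 0 l.

End correction_factor.

(* Main.v *)
From HB Require Import structures.
From mathcomp Require Import all_boot all_order all_algebra.
From mathcomp Require Import all_classical all_reals all_analysis.
From mathcomp Require Import measurable_realfun.
From mathcomp Require Import ring lra zify.
Require Import Defs.

Set Implicit Arguments.
Unset Strict Implicit.
Unset Printing Implicit Defensive.

Import Order.TTheory GRing.Theory Num.Theory.
Import numFieldNormedType.Exports.

Local Open Scope classical_set_scope.
Local Open Scope ring_scope.
Local Open Scope card_scope.


(** Write [m2] for the second moment of the volume of the typical cell and [kap] for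
    the volume of the unit ball. Both conditions of the equivalence say that
    [rho = lam ^+ 2 * m2].

    The ratio of the mean volumes. A point [y] is in the typical cell when the open
    ball around [y] through the origin contains no nucleus, so the first two moments
    of the volume are integrals of void probabilities ([mean_mu_cell],
    [mean_mu_cell2]). The mean is [lam^-1] ([mean_mu_typical]), and [m2] is the double
    integral of [exp (- lam * |B(x, |x|) u B(y, |y|)|)]. For the zero cell, [y] is in it
    when the nucleus [x] nearest to the origin is also the nearest to [y]. Summing
    over the possible nuclei, its mean volume should be [lam] times the double
    integral of [exp (- lam * |B(0, |x|) u B(y, |x - y|)|)], which the translation by
    [- x] turns into [lam * m2] ([integral_exp_shell0]). This instance of Mecke's
    formula is derived from the finite-dimensional distributions
    ([mean_mu_zero_cell]). Space is cut into small cubes with reference points. If a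
    cube contains exactly one nucleus and there is no other one in the two balls,
    slightly enlarged, then [y] is in the zero cell. If [y] is in the zero cell, then
    some cube contains a nucleus and the two balls, slightly shrunk, contain none.
    These events have explicit probabilities; the sums over the cubes are bounded by
    integrals whose only dependence on the grid is a change of the radii, and
    dominated convergence gives the same limit for both bounds.

    The correction factor. The function [G] is a combination, with coefficients that
    depend on [lam] and [m2], of the mean of [Z1] and of the mean of [Z1 * Z2] ([GE]).
    These means are [r ^+ d * f1 r] and [r ^+ d * f2 r], where [f1] tends to [kap] and
    [f2] to [kap / lam] as [r] decreases to [0], because the probability
    that a point is in the typical cell tends to [1] near the origin. Hence [G r / r ^+ d] tends to
    [kap * lam ^+ 3 * m2], whereas for the exponential approximation the limit is
    [rho * lam * kap]. These limits are the [d]-th derivatives divided by [d!], but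
    only if the derivatives exist, and the [f] above need not be differentiable
    at [0]. What makes the argument work is that they are functions of [s = r ^+ d]
    given by Laplace integrals, to which the operator [s d/ds] can be applied
    repeatedly with limits at [0] ([euler_smooth_laplace]): this regularity,
    [euler_smooth], is preserved by the substitution [s = r ^+ d] and is enough to
    differentiate [r ^+ d * f r] at [0] from the right [d] times
    ([is_derivn_within_euler_smooth]). *)

(** * Affine changes of variables *)

(** [pushforward m f] with a measure structure that records the proof that [f] is
    measurable. *)
Definition image_measure d1 d2 (X : measurableType d1) (Y : measurableType d2)
    (R : realType) (m : {measure set X -> \bar R}) (f : X -> Y)
    (mf : measurable_fun setT f) : {measure set Y -> \bar R} :=
  measure_function_pushforward__canonical__measure_function_Measure m mf.

Section affine_line.
Context {R : realType}.
Local Notation lambda := (@lebesgue_measure R).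

Lemma measurable_affine (a b : R) :
  measurable_fun [set: measurableTypeR R] (fun x : measurableTypeR R => (a * x + b : measurableTypeR R)).
Proof. by apply: measurable_funD => //; apply: measurable_funM. Qed.

(** The right-hand side is a measure in [A], so it is enough to compare both sides
    on half-open intervals. *)
Lemma lebesgue_measure_affine (a b : R) (A : set (measurableTypeR R)) :
  a != 0 -> measurable A ->
  (lambda A = (`|a|)%:E * lambda ((fun x => (a * x + b)%R) @^-1` A))%E.
Proof.
move=> a0 mA.
pose f := fun x : measurableTypeR R => (a * x + b : measurableTypeR R).
have mf : measurable_fun setT f := measurable_affine a b.
have a0' : 0 <= `|a| by [].
have -> : (`|a|%:E * lambda (f @^-1` A))%E = mscale (NngNum a0') (image_measure lambda mf) A by [].
apply: lebesgue_measure_unique => //.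
move=> _ [[l r] _ <-]; rewrite [RHS](_ : _ = (`|a|%:E * lambda (f @^-1` `]l, r]))%E) //=.
have [ap|an] := ltP 0 a.
  have -> : f @^-1` `]l, r] = `](l - b) / a, (r - b) / a]%classic.
    apply/seteqP; split => x /=; rewrite !in_itv/= /f ltr_pdivrMr// ler_pdivlMr//.
      by move=> /andP[? ?]; apply/andP; split; rewrite mulrC; lra.
    by move=> /andP[]; rewrite mulrC => ? ?; apply/andP; split; lra.
  rewrite !lebesgue_measure_itv/= !lte_fin ltr_pM2r ?invr_gt0// ltrD2r.
  case: ifPn => _; last by rewrite mule0.
  by rewrite -!EFinD -EFinM gtr0_norm//; congr EFin; field.
have {a0 an}an : a < 0 by rewrite lt_neqAle a0.
have -> : f @^-1` `]l, r] = `[(r - b) / a, (l - b) / a[%classic.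
  apply/seteqP; split => x /=; rewrite !in_itv/= /f ler_ndivrMr// ltr_ndivlMr//.
    by move=> /andP[? ?]; apply/andP; split; rewrite mulrC; lra.
  by move=> /andP[]; rewrite mulrC => ? ?; apply/andP; split; lra.
rewrite !lebesgue_measure_itv/= !lte_fin ltr_nM2r ?invr_lt0// ltrD2r.
case: ifPn => _; last by rewrite mule0.
by rewrite -!EFinD -EFinM ltr0_norm//; congr EFin; field; rewrite lt_eqF.
Qed.

Lemma integral_affine (a b : R) (f : measurableTypeR R -> \bar R) :
  a != 0 -> measurable_fun setT f -> (forall x, 0 <= f x)%E ->
  (\int[lambda]_x f x = `|a|%:E * \int[lambda]_x f (a * x + b)%R)%E.
Proof.
move=> a0 mf f0.
pose g := fun x : measurableTypeR R => (a * x + b : measurableTypeR R).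
have mg : measurable_fun setT g := measurable_affine a b.
have a0' : 0 <= `|a| by [].
rewrite -[RHS]/(`|a|%:E * \int[lambda]_(x in g @^-1` setT) (f \o g) x)%E.
rewrite -(ge0_integral_pushforward mg) // -[pushforward _ _]/(image_measure lambda mg : set _ -> _).
rewrite -(@ge0_integral_mscale _ _ R (image_measure lambda mg) setT measurableT (NngNum a0') f) //.
apply: eq_measure_integral => A mA _.
exact: (lebesgue_measure_affine b a0 mA).
Qed.

End affine_line.

Section affine_space.
Context {R : realType}.
Local Notation mu d := (lebesgue_measure_vec R d).

Definition affine d (a : R) (b x : Rvec R d) : Rvec R d :=
  [tuple (a * tnth x i + tnth b i)%R | i < d].

Lemma tnth_affine d (a : R) (b x : Rvec R d) i :
  tnth (affine a b x) i = (a * tnth x i + tnth b i)%R.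
Proof. by rewrite tnth_mktuple. Qed.

Lemma measurable_affine_vec d (a : R) (b : Rvec R d) :
  measurable_fun setT (affine a b).
Proof.
apply/measurable_fun_tnthP => i.
rewrite (_ : _ \o _ = (fun x : measurableTypeR R => (a * x + tnth b i : measurableTypeR R)) \o
  (fun x : Rvec R d => tnth x i)); last by apply/funext => x /=; rewrite tnth_affine.
apply: measurableT_comp; first exact: measurable_affine.
exact: measurable_tnth.
Qed.

Lemma integral_vecS d (f : Rvec R d.+1 -> \bar R) :
  measurable_fun setT f -> (forall x, 0 <= f x)%E ->
  (\int[mu d.+1]_x f x = \int[lebesgue_measure]_x \int[mu d]_y f (tcons (x, y)))%E.
Proof.
move=> mf f0.
have mft : measurable_fun setT (f \o @tcons R d).
  exact: measurableT_comp (@measurable_tcons R d).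
rewrite /= /lebesgue_cons.
rewrite (ge0_integral_pushforward (@measurable_tcons R d) _ measurableT mf); last by [].
by rewrite preimage_setT (fubini_tonelli1 _ mft) //= => -[x y]; exact: f0.
Qed.

Lemma measurable_fun_vecS d (f : Rvec R d.+1 -> \bar R) :
  measurable_fun setT f -> (forall x, 0 <= f x)%E ->
  measurable_fun setT (fun x : measurableTypeR R => \int[mu d]_y f (tcons (x, y)))%E.
Proof.
move=> mf f0.
apply: (@measurable_fun_fubini_tonelli_F _ _ _ _ R (mu d) (f \o @tcons R d)).
  exact: measurableT_comp (@measurable_tcons R d).
by move=> x; exact: f0.
Qed.

(** Induction on the dimension: peel off the first coordinate and change variables
    on the line. *)
Lemma integral_vec_affine d (a : R) (b : Rvec R d) (f : Rvec R d -> \bar R) :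
  a != 0 -> measurable_fun setT f -> (forall x, 0 <= f x)%E ->
  (\int[mu d]_x f x = (`|a| ^+ d)%:E * \int[mu d]_x f (affine a b x))%E.
Proof.
move=> a0; elim: d b f => [|d IH] b f mf f0.
  rewrite expr0 mul1e; apply: eq_integral => x _; congr f.
  by apply: eq_from_tnth => -[].
have mfa : measurable_fun setT (f \o affine a b).
  by apply: measurableT_comp => //; exact: measurable_affine_vec.
rewrite (integral_vecS mf f0).
rewrite (integral_vecS mfa) => [|x]; last exact: f0.
pose b' : Rvec R d := [tuple of behead b].
rewrite (integral_affine (thead b) a0); last 2 first.
- exact: measurable_fun_vecS.
- by move=> x; apply: integral_ge0.
rewrite exprS EFinM -muleA; congr (_ * _)%E.
rewrite -ge0_integralZl_EFin ?exprn_ge0 //; last 2 first.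
- move=> x _. apply: integral_ge0 => y _. exact: f0.
- by apply: (measurable_fun_vecS mfa) => z; exact: f0.
apply: eq_integral => x _.
have mft : measurable_fun setT (fun y => f (tcons (a * x + thead b, y)))%R.
  apply: (measurableT_comp mf).
  apply: (measurableT_comp (@measurable_tcons R d)).
  exact: measurable_pair1.
rewrite (IH b' _ mft) //=; congr (_ * _)%E.
apply: eq_integral => y _; congr f.
apply: eq_from_tnth => i; rewrite tnth_affine.
rewrite (_ : tnth b i = tnth (tcons (thead b, b')) i); last first.
  by congr tnth; rewrite [LHS]tuple_eta; apply: val_inj.
case: (unliftP ord0 i) => [j|] ->; rewrite /tcons /= ?tnthS ?tnth0 //.
by rewrite tnth_affine.
Qed.

Lemma measure_affine d (a : R) (b : Rvec R d) (A : set (Rvec R d)) :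
  a != 0 -> measurable A ->
  (mu d A = (`|a| ^+ d)%:E * mu d (affine a b @^-1` A))%E.
Proof.
move=> a0 mA.
rewrite -[X in mu d X]setIT -[in RHS](setIT (_ @^-1` _)) -!integral_indic //; last first.
  by rewrite -[_ @^-1` _]setTI; exact: measurable_affine_vec.
rewrite (integral_vec_affine b a0) //.
by apply/measurable_EFinP; exact: measurable_indic.
Qed.

End affine_space.

(** * Euclidean distance, balls and layers *)

Section measurable_tools.
Context {dT : measure_display} {T : measurableType dT} {R : realType}.

Lemma measurable_set_lt (f g : T -> R) :
  measurable_fun setT f -> measurable_fun setT g -> measurable [set x | f x < g x].
Proof.
move=> mf mg.
have mt : measurable [set true] by [].
have := measurable_fun_ltr mf mg measurableT mt.
by rewrite setTI; congr measurable; apply/seteqP; split => x /=.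
Qed.

Lemma measurable_set_le (f g : T -> R) :
  measurable_fun setT f -> measurable_fun setT g -> measurable [set x | f x <= g x].
Proof.
move=> mf mg.
rewrite (_ : [set x | _] = ~` [set x | g x < f x]).
  by apply: measurableC; exact: measurable_set_lt.
by apply/seteqP; split => x /=; rewrite leNgt => /negP.
Qed.

Lemma measurable_fun_sumr (I : Type) (s : seq I) (h : I -> T -> R) :
  (forall i, measurable_fun setT (h i)) -> measurable_fun setT (fun x => \sum_(i <- s) h i x).
Proof.
move=> mh; elim: s => [|i s IH]; first by under eq_fun do rewrite big_nil; exact: measurable_cst.
by under eq_fun do rewrite big_cons; exact: measurable_funD.
Qed.

End measurable_tools.

Section euclid.
Context {R : realType} {d : nat}.
Implicit Types x y z b : Rvec R d.

Lemma edistC x y : edist x y = edist y x.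
Proof. by rewrite /edist; congr Num.sqrt; apply: eq_bigr => i _; rewrite -sqrrN opprB. Qed.

Lemma edist_ge0 x y : 0 <= edist x y.
Proof. exact: sqrtr_ge0. Qed.

Lemma sqr_edist x y : edist x y ^+ 2 = \sum_(i < d) (tnth x i - tnth y i : R) ^+ 2.
Proof. by rewrite /edist sqr_sqrtr// sumr_ge0// => i _; rewrite sqr_ge0. Qed.

Lemma edist_triangle y x z : edist x z <= edist x y + edist y z.
Proof.
rewrite -(@ler_pXn2r _ 2) ?nnegrE ?addr_ge0 ?edist_ge0//.
rewrite sqrrD !sqr_edist.
pose u i : R := tnth x i - tnth y i; pose v i : R := tnth y i - tnth z i.
have -> : \sum_(i < d) (tnth x i - tnth z i : R) ^+ 2 =
    \sum_i u i ^+ 2 + (\sum_i u i * v i) *+ 2 + \sum_i v i ^+ 2.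
  rewrite -sumrMnl -!big_split /=; apply: eq_bigr => i _.
  by rewrite -sqrrD /u /v addrA subrK.
rewrite lerD2r lerD2l lerMn2r /=.
suff cs : (\sum_i u i * v i) ^+ 2 <= (edist x y * edist y z) ^+ 2.
  apply: (le_trans (ler_norm _)).
  by rewrite -(@ler_pXn2r _ 2) ?nnegrE ?mulr_ge0 ?edist_ge0// real_normK ?num_real.
rewrite exprMn !sqr_edist -/u -/v.
(* The Cauchy-Schwarz inequality, by Lagrange's identity *)
have : 0 <= \sum_i \sum_j (u i * v j - u j * v i) ^+ 2.
  by apply: sumr_ge0 => i _; apply: sumr_ge0 => j _; rewrite sqr_ge0.
have -> : \sum_i \sum_j (u i * v j - u j * v i) ^+ 2 =
    ((\sum_i u i ^+ 2) * (\sum_i v i ^+ 2) - (\sum_i u i * v i) ^+ 2) *+ 2.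
  have E i : \sum_j (u i * v j - u j * v i) ^+ 2 = u i ^+ 2 * (\sum_j v j ^+ 2)
      + v i ^+ 2 * (\sum_j u j ^+ 2) - (u i * v i) * (\sum_j u j * v j) *+ 2.
    rewrite !mulr_sumr -sumrMnl -big_split -sumrB /=.
    by apply: eq_bigr => j _; ring.
  rewrite (eq_bigr _ (fun i _ => E i)) sumrB big_split /= sumrMnl -!mulr_suml.
  ring.
by rewrite pmulrn_lge0// subr_ge0.
Qed.

Lemma edist_affine (a : R) b x y :
  edist (affine a b x) (affine a b y) = `|a| * edist x y.
Proof.
rewrite /edist -sqrtr_sqr -sqrtrM ?sqr_ge0//; congr Num.sqrt.
rewrite mulr_sumr; apply: eq_bigr => i _; rewrite !tnth_affine -exprMn.
by congr (_ ^+ 2); ring.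
Qed.

Lemma tnth_origin i : tnth (@origin R d) i = 0.
Proof. by rewrite tnth_mktuple. Qed.

(** Voronoi cells are closed, so the events that they contain given points are void
    events of open balls. *)
Definition oball x (r : R) : set (Rvec R d) := [set y | edist y x < r].

Lemma oballWle x r s : r <= s -> oball x r `<=` oball x s.
Proof. by move=> rs y /lt_le_trans; apply. Qed.

Lemma oball_sub_eball0 x r :
  oball x r `<=` eball (@origin R d) (edist x origin + r).
Proof.
move=> z zx; rewrite /eball /= (le_trans (edist_triangle x _ _))//.
by rewrite addrC lerD2l ltW.
Qed.

End euclid.

Section measurable_euclid.
Context {R : realType} {d : nat} {dT : measure_display} {T : measurableType dT}.
Implicit Types (f g : T -> Rvec R d).

Lemma measurable_fun_edist f g : measurable_fun setT f -> measurable_fun setT g ->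
  measurable_fun setT (fun w => edist (f w) (g w)).
Proof.
move=> mf mg; rewrite /edist.
apply: (@measurableT_comp _ _ _ _ _ _ (@Num.sqrt R)).
  by apply: continuous_measurable_fun; exact: sqrt_continuous.
apply: (@measurable_fun_sumr _ T R _ (index_enum 'I_d)
  (fun i w => (tnth (f w) i - tnth (g w) i : R) ^+ 2)) => i.
apply: measurable_funX; apply: measurable_funB.
- exact: (proj1 (measurable_fun_tnthP f) mf i).
- exact: (proj1 (measurable_fun_tnthP g) mg i).
Qed.

Lemma measurable_fun_norm f : measurable_fun setT f ->
  measurable_fun setT (fun w => edist (f w) origin).
Proof. by move=> mf; apply: measurable_fun_edist => //; exact: measurable_cst. Qed.

End measurable_euclid.

Section balls.
Context {R : realType} {d : nat}.
Implicit Types x y z b : Rvec R d.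
Local Notation mu := (lebesgue_measure_vec R d).

Lemma measurable_oball x r : measurable (oball x r).
Proof.
apply: measurable_set_lt; last exact: measurable_cst.
by apply: measurable_fun_edist; [exact: measurable_id | exact: measurable_cst].
Qed.

Lemma measurable_eball x r : measurable (eball x r).
Proof.
apply: measurable_set_le; last exact: measurable_cst.
by apply: measurable_fun_edist; [exact: measurable_id | exact: measurable_cst].
Qed.

Definition unit_ball_volume := fine (mu (oball origin 1)).

Lemma affine_origin (a : R) x : affine a x origin = x.
Proof. by apply: eq_from_tnth => i; rewrite tnth_affine tnth_origin mulr0 add0r. Qed.

Lemma affine_oball (a : R) x r : 0 < a ->
  affine a x @^-1` (oball x (a * r)) = oball origin r.
Proof.
move=> a0; rewrite -[X in oball X (a * r)](affine_origin a).
by apply/seteqP; split => y; rewrite /oball /= edist_affine gtr0_norm// ltr_pM2l.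
Qed.

Lemma mu_oball1 x r : 0 < r -> (mu (oball x r) = (r ^+ d)%:E * mu (oball origin 1))%E.
Proof.
move=> r0; rewrite (@measure_affine _ _ r x) ?gt_eqF//; last exact: measurable_oball.
by rewrite -[X in oball x X]mulr1 affine_oball// gtr0_norm.
Qed.

End balls.

Section layer_cake.
Context {R : realType}.
Local Notation lambda := (@lebesgue_measure R).
Local Open Scope ereal_scope.

Lemma integral_expRN (a : R) :
  \int[lambda]_(s in `]a, +oo[) (expR (- s))%:E = (expR (- a))%:E.
Proof.
rewrite integral_itv_obnd_cbnd; last first.
  apply/measurable_EFinP; apply: measurable_funTS; apply: measurableT_comp => //.
have dF (x : R) : is_derive x (1%R : R) (fun s => - expR (- s))%R (expR (- x)).
  apply: is_derive_eq; rewrite ?oppr0 ?scaleNr ?scalerN ?opprK.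
  by rewrite mulrN1 opprK.
rewrite (@ge0_continuous_FTC2y R (fun s => expR (- s)) (fun s => - expR (- s))%R a 0%R).
- by rewrite sub0e EFinN oppeK.
- by move=> x _; exact: expR_ge0.
- apply: continuous_subspaceT => x; apply: continuous_comp; first exact: opp_continuous.
  exact: continuous_expR.
- rewrite -oppr0; apply: cvgN; exact: cvgr_expR.
- by move=> x _; apply: ex_derive.
- apply: cvg_at_right_filter; apply: cvgN; apply: continuous_comp; first exact: opp_continuous.
  exact: continuous_expR.
- by move=> x _; rewrite derive1E; apply: derive_val.
Qed.

(** Layer cake: [expR (- g x)] is the integral of [expR (- s)] over [s > g x], and
    the order of integration is exchanged. *)
Lemma integral_expRN_layer (dT : measure_display) (X : measurableType dT)
    (m : {sigma_finite_measure set X -> \bar R}) (g : X -> R) :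
  measurable_fun setT g -> (forall x, 0 <= g x)%R ->
  \int[m]_x (expR (- g x))%:E =
  \int[lambda]_(s in `]0%R, +oo[) ((expR (- s))%:E * m [set x | (g x < s)%R]).
Proof.
move=> mg g0.
pose A : set (X * measurableTypeR R) := [set p | (g p.1 < p.2)%R].
have mA : measurable A.
  apply: measurable_set_lt; last exact: measurable_snd.
  exact: measurableT_comp measurable_fst.
pose f (p : X * measurableTypeR R) : \bar R := ((expR (- p.2))%:E * (\1_A p)%:E).
have mf : measurable_fun setT f.
  apply: emeasurable_funM; apply/measurable_EFinP; last exact: measurable_indic.
  apply: measurableT_comp => //; apply: measurableT_comp => //; exact: measurable_snd.
have f0 p : 0 <= f p by rewrite mule_ge0// lee_fin ?expR_ge0.
transitivity (\int[m]_x \int[lambda]_s f (x, s)).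
  apply: eq_integral => x _; rewrite -integral_expRN integral_mkcond.
  apply: eq_integral => s _; rewrite /f /patch /= indicE.
  rewrite mem_setE in_itv/= andbT.
  have -> : ((x, s) \in A) = (g x < s)%R by apply/idP/idP; rewrite inE.
  by case: ifPn => _; rewrite ?mule1 ?mule0.
rewrite (fubini_tonelli _ mf f0) [RHS]integral_mkcond.
apply: eq_integral => s _; rewrite /f /patch /= mem_setE in_itv/= andbT.
have mS : measurable [set x | (g x < s)%R].
  by apply: measurable_set_lt => //; exact: measurable_cst.
have ES x : (\1_A (x, s) : R) = \1_([set x | (g x < s)%R]) x.
  by rewrite !indicE; congr (_%:R); apply/idP/idP; rewrite !inE.
under eq_integral do rewrite ES.
rewrite ge0_integralZl_EFin ?expR_ge0//; last first.
  by apply/measurable_EFinP; exact: measurable_indic.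
rewrite integral_indic// setIT.
case: ifPn => // s0; rewrite (_ : [set x | _] = set0) ?measure0 ?mule0//.
apply/seteqP; split => x //=; rewrite -leNgt in s0.
by move=> /(le_lt_trans (g0 x))/lt_le_trans /(_ s0); rewrite ltxx.
Qed.

End layer_cake.

(** * The volume of a ball *)

Section gauss.
Context {R : realType}.
Local Open Scope ereal_scope.

Lemma measurable_sqnorm d :
  measurable_fun setT (fun x : Rvec R d => (edist x origin ^+ 2)%R).
Proof. by apply: measurable_funX; apply: measurable_fun_norm; exact: measurable_id. Qed.

Lemma integral_gauss_vec d :
  \int[lebesgue_measure_vec R d]_x (expR (- (edist x origin ^+ 2)))%:E =
  (Num.sqrt pi ^+ d)%:E.
Proof.
have mg k : measurable_fun setT (fun x : Rvec R k => (expR (- (edist x origin ^+ 2)))%:E).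
  apply/measurable_EFinP; apply: measurableT_comp => //; apply: measurableT_comp => //.
  exact: measurable_sqnorm.
have g0 k (x : Rvec R k) : 0 <= (expR (- (edist x origin ^+ 2)))%:E.
  by rewrite lee_fin expR_ge0.
elim: d => [|d IH].
  rewrite integral_dirac//; last exact: mg.
  by rewrite diracT mul1e sqr_edist big_ord0 oppr0 expR0 expr0.
rewrite (integral_vecS (mg _) (g0 _)).
transitivity (\int[@lebesgue_measure R]_x ((Num.sqrt pi ^+ d)%:E * (gauss_fun x)%:E)).
  apply: eq_integral => x _; rewrite -IH muleC -ge0_integralZl_EFin ?expR_ge0//; last exact: mg.
  apply: eq_integral => y _; rewrite -EFinM -expRD; congr (expR _)%:E.
  rewrite sqr_edist big_ord_recl opprD; congr (- (_ ^+ 2) + - _)%R.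
    by rewrite tnth0 tnth_origin subr0.
  by rewrite sqr_edist; apply: eq_bigr => i _; rewrite tnthS !tnth_origin.
rewrite ge0_integralZl_EFin//; last 2 first.
- by move=> x _; rewrite lee_fin gauss_fun_ge0.
- apply/measurable_EFinP; exact: measurable_gauss_fun.
by rewrite integralT_gauss exprSr EFinM.
Qed.

(** The layer-cake formula on the line for [|t|]: the level sets are intervals of
    length [2 s], and the integral of [expR (- |t|)] is [2] by symmetry. *)
Lemma integral_expR_mulr : \int[@lebesgue_measure R]_(s in `]0%R, +oo[) (expR (- s) * s)%:E = 1.
Proof.
have mN : measurable_fun setT (fun t : measurableTypeR R => (`|t|%R : R)).
  by apply: continuous_measurable_fun; exact: norm_continuous.
have mE : measurable_fun setT (fun t : measurableTypeR R => (expR (- `|t|))%:E).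
  apply/measurable_EFinP; apply: measurableT_comp => //; exact: measurableT_comp.
have two : \int[@lebesgue_measure R]_t (expR (- `|t|))%:E = 2%:E.
  have -> : [set: R] = `]-oo, 0%R] `|` `]0%R, +oo[.
    by apply/seteqP; split => x //= _; rewrite !in_itv/= andbT; apply/orP; case: (leP x 0%R).
  rewrite ge0_integral_setU//=; last 2 first.
  - by apply: measurable_funTS.
  - apply/disj_setPS => x /=; rewrite !in_itv/= andbT => -[x0].
    by rewrite ltNge x0.
  have E1 : \int[@lebesgue_measure R]_(t in `]0%R, +oo[) (expR (- `|t|))%:E = 1.
    rewrite -(expR0) -[X in expR X]oppr0 -integral_expRN; apply: eq_integral => x.
    by rewrite inE/= in_itv/= andbT => x0; rewrite gtr0_norm.
  rewrite E1.
  have := @ge0_integration_by_substitution0 R (fun t => (expR (- `|t|))%:E) mE (fun t => _).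
  rewrite -integral_itv_obnd_cbnd ?E1; last by apply: measurable_funTS.
  have -> : (fun t : R => (expR (- `|- t|))%:E) = (fun t => (expR (- `|t|))%:E).
    by apply/funext => t; rewrite normrN.
  by move=> <- // t; rewrite lee_fin expR_ge0.
have := @integral_expRN_layer R _ (measurableTypeR R) (@lebesgue_measure R) (fun t => `|t|)%R
  mN (fun t => normr_ge0 t).
rewrite two.
have -> : \int[@lebesgue_measure R]_(s in `]0%R, +oo[)
     ((expR (- s))%:E * lebesgue_measure [set x | (`|x| < s)%R]) =
   2%:E * \int[@lebesgue_measure R]_(s in `]0%R, +oo[) (expR (- s) * s)%:E.
  rewrite -ge0_integralZl_EFin//; last 2 first.
  - by move=> s; rewrite /= in_itv/= andbT => s0; rewrite lee_fin mulr_ge0 ?expR_ge0 ?ltW.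
  - apply/measurable_EFinP/measurable_funTS; apply: measurable_funM => //.
    exact: measurableT_comp.
  apply: eq_integral => s; rewrite inE/= in_itv/= andbT => s0.
  rewrite (_ : [set x | _] = ball (0 : R)%R s); last first.
    by apply/seteqP; split => x /=; rewrite /ball/= sub0r normrN.
  rewrite lebesgue_measure_ball ?ltW// -!EFinM; congr EFin.
  by rewrite mulr2n; ring.
move=> /(congr1 (fun x => (2^-1)%:E * x)).
by rewrite muleA -!EFinM mulVf// mul1e => <-.
Qed.

End gauss.

Section ball_volume.
Context {R : realType} {d : nat}.
Local Notation mu := (lebesgue_measure_vec R d).
Local Notation kap := (@unit_ball_volume R d).

(** Both sides of [kap * Gamma(d/2 + 1) = pi^(d/2)] are the Gaussian integral
    over the whole space: as a product of one-dimensional integrals, and by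
    integrating the volumes of its level sets, which are balls. *)
Lemma mu_unit_ball_gamma :
  (mu (oball origin 1) *
   \int[@lebesgue_measure R]_(s in `]0%R, +oo[) (expR (- s) * Num.sqrt s ^+ d)%:E =
   (Num.sqrt pi ^+ d)%:E)%E.
Proof.
rewrite -integral_gauss_vec integral_expRN_layer; last 2 first.
- exact: measurable_sqnorm.
- by move=> x; rewrite sqr_ge0.
rewrite -ge0_integralZl//; last first.
  apply/measurable_EFinP/measurable_funTS; apply: measurable_funM.
    by apply: measurableT_comp => //.
  apply: measurable_funX; apply: continuous_measurable_fun; exact: sqrt_continuous.
apply: eq_integral => s; rewrite inE/= in_itv/= andbT => s0.
have -> : [set x : Rvec R d | edist x origin ^+ 2 < s] = oball origin (Num.sqrt s).
  apply/funext => x; apply/propext; rewrite /oball /= -{1}(sqr_sqrtr (ltW s0)).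
  by rewrite ltr_pXn2r ?nnegrE ?edist_ge0 ?sqrtr_ge0.
by rewrite [in RHS]mu_oball1 ?sqrtr_gt0// EFinM muleC -muleA.
Qed.

Lemma mu_unit_ball : mu (oball origin 1) = kap%:E /\ 0 < kap.
Proof.
have := mu_unit_ball_gamma; set I := (\int[_]_(s in _) _)%E => KI.
have I0 : (0 <= I)%E.
  by apply: integral_ge0 => s _; rewrite lee_fin mulr_ge0 ?expR_ge0 ?exprn_ge0 ?sqrtr_ge0.
have K0 : (0 <= mu (oball origin 1))%E by exact: measure_ge0.
have p0 : 0 < Num.sqrt pi ^+ d :> R by rewrite exprn_gt0// sqrtr_gt0 pi_gt0.
have Kfin : mu (oball origin 1) \is a fin_num.
  rewrite ge0_fin_numE// ltNge leye_eq; apply/negP => /eqP Ky; move: KI; rewrite Ky.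
  move: I0; rewrite le_eqVlt => /orP[/eqP <-|I0]; first by rewrite mule0 => -[] p0'; rewrite -p0' ltxx in p0.
  by rewrite gt0_mulye.
split; first by rewrite fineK.
rewrite lt_neqAle fine_ge0// andbT; apply/eqP => k0.
by move: KI; rewrite -(fineK Kfin) -/kap -k0 mul0e => -[] p0'; rewrite -p0' ltxx in p0.
Qed.

Lemma kap_gt0 : 0 < kap. Proof. by case: mu_unit_ball. Qed.

Lemma kapE : kap = kappa R d.
Proof.
have := mu_unit_ball_gamma; rewrite (proj1 mu_unit_ball); set I := (\int[_]_(s in _) _)%E => KI.
have k0 := kap_gt0.
have I0 : (0 <= I)%E.
  by apply: integral_ge0 => s _; rewrite lee_fin mulr_ge0 ?expR_ge0 ?exprn_ge0 ?sqrtr_ge0.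
have Ifin : I \is a fin_num.
  rewrite ge0_fin_numE// ltNge leye_eq; apply/negP => /eqP Iy; move: KI.
  by rewrite Iy gt0_muley ?lte_fin.
move: KI; rewrite -(fineK Ifin) -EFinM => -[KI].
have G : Gamma_fun (d%:R / 2 + 1) = fine I.
  rewrite /Gamma_fun /Rintegral; congr fine; apply: eq_integral => t.
  rewrite inE/= in_itv/= andbT => t0; rewrite addrK mulrC (mulrC d%:R) powRrM.
  by rewrite powR12_sqrt ?ltW// powR_mulrn ?sqrtr_ge0.
rewrite /kappa G (mulrC d%:R) powRrM powR12_sqrt ?pi_ge0// powR_mulrn ?sqrtr_ge0// -KI mulfK//.
apply/eqP => I00; have : 0 < Num.sqrt pi ^+ d :> R by rewrite exprn_gt0// sqrtr_gt0 pi_gt0.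
by rewrite -KI I00 mulr0 ltxx.
Qed.

Hypothesis d0 : (0 < d)%N.

Lemma mu_oball x r : 0 <= r -> mu (oball x r) = (kap * r ^+ d)%:E.
Proof.
rewrite le_eqVlt => /orP[/eqP <-|r0].
  rewrite expr0n gtn_eqF// mulr0 (_ : oball x 0 = set0) ?measure0//.
  by apply/seteqP; split => y //=; rewrite /oball/= ltNge edist_ge0.
by rewrite mu_oball1// (proj1 mu_unit_ball) -EFinM mulrC.
Qed.

(** Balls of slightly larger radius squeeze the closed ball onto the open one. *)
Lemma mu_eball x r : 0 <= r -> mu (eball x r) = (kap * r ^+ d)%:E.
Proof.
move=> r0; apply/eqP; rewrite eq_le; apply/andP; split; last first.
  rewrite -(mu_oball x r0); apply: le_measure; rewrite ?inE.
  - exact: measurable_oball.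
  - exact: measurable_eball.
  - by move=> y; exact: ltW.
apply/lee_addgt0Pr => e e0.
have cont : kap * x ^+ d @[x --> r^'+] --> kap * r ^+ d.
  apply: cvgMr; apply: cvg_at_right_filter; exact: exprn_continuous.
have /cvgrPdist_le /(_ _ e0) near_le := cont.
near r^'+ => s.
have rs : r < s by near: s; exact: nbhs_right_gt.
apply: (@le_trans _ _ (mu (oball x s))).
  apply: le_measure; rewrite ?inE.
  - exact: measurable_eball.
  - exact: measurable_oball.
  - by move=> y /le_lt_trans; apply.
rewrite mu_oball ?(ltW (le_lt_trans r0 rs))// lee_fin -lerBlDl.
apply: le_trans (ler_norm _) _; rewrite distrC.
by near: s.
Unshelve. all: by end_near. Qed.

(** By layers again: the set where [c * |x| ^ d < s] is a ball of volume
    [kap * s / c]. *)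
Lemma integral_expRN_norm (c : R) : 0 < c ->
  (\int[mu]_x (expR (- (c * edist x origin ^+ d)))%:E = (kap / c)%:E)%E.
Proof.
move=> c0; rewrite integral_expRN_layer; last 2 first.
- apply: measurable_funM; first exact: measurable_cst.
  by apply: measurable_funX; apply: measurable_fun_norm; exact: measurable_id.
- by move=> x; rewrite mulr_ge0 ?exprn_ge0 ?edist_ge0 ?ltW.
rewrite -[RHS]mule1 -(@integral_expR_mulr R) -ge0_integralZl_EFin//; last 3 first.
- by move=> s; rewrite /= in_itv/= andbT => s0; rewrite lee_fin mulr_ge0 ?expR_ge0 ?ltW.
- apply/measurable_EFinP/measurable_funTS; apply: measurable_funM => //.
  exact: measurableT_comp.
- by rewrite divr_ge0 ?ltW// kap_gt0.
apply: eq_integral => s; rewrite inE/= in_itv/= andbT => s0.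
pose r := (s / c) `^ (d%:R^-1).
have sc : 0 <= s / c by rewrite divr_ge0 ?ltW.
have rd : r ^+ d = s / c.
  by rewrite -powR_mulrn ?powR_ge0// -powRrM mulVf ?powRr1// pnatr_eq0 -lt0n.
have -> : [set x : Rvec R d | c * edist x origin ^+ d < s] = oball origin r.
  apply/funext => x; apply/propext; rewrite /oball /= mulrC -ltr_pdivlMr// -rd.
  by rewrite ltr_pXn2r ?nnegrE ?edist_ge0 ?powR_ge0.
rewrite mu_oball ?powR_ge0// rd -!EFinM; congr EFin; field.
by rewrite gt_eqF.
Qed.

End ball_volume.

(** * The Poisson process on a grid of cubes *)

Section cells.
Context {R : realType} {d : nat}.
Implicit Types x y : Rvec R d.

(** The fibres of this index are the half-open cubes of side [1 / n.+1] of a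
    grid; numbering them by natural numbers makes sigma-additivity directly
    applicable. *)
Definition cell_index (n : nat) x : nat :=
  pickle [tuple Num.floor ((tnth x i : R) * n.+1%:R) | i < d].

Definition cell (n k : nat) : set (Rvec R d) := [set x | cell_index n x = k].

(** An upper bound for the diameter of the cubes: it exceeds [sqrt d / n.+1]. *)
Definition mesh (n : nat) : R := d.+1%:R / n.+1%:R.

Definition cell_point (n k : nat) : Rvec R d := get (cell n k).

Lemma mesh_gt0 n : 0 < mesh n. Proof. by rewrite divr_gt0. Qed.

Lemma cvg_mesh : mesh n @[n --> \oo] --> 0.
Proof.
rewrite -(mulr0 (d.+1%:R : R)); apply: cvgMr.
exact: (@cvg_harmonic R).
Qed.

Lemma cell_indexP n x y : cell_index n x = cell_index n y <->
  forall i, Num.floor ((tnth x i : R) * n.+1%:R) = Num.floor ((tnth y i : R) * n.+1%:R).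
Proof.
split=> [/(pcan_inj pickleK) h i|h].
  by have := congr1 (fun t => tnth t i) h; rewrite !tnth_mktuple.
by congr pickle; apply: eq_from_tnth => i; rewrite !tnth_mktuple.
Qed.

Lemma edist_cell n k x y : cell n k x -> cell n k y -> edist x y < mesh n.
Proof.
move=> xk yk; have /cell_indexP h : cell_index n x = cell_index n y by rewrite xk yk.
rewrite -(@ltr_pXn2r _ 2) ?nnegrE ?edist_ge0 ?ltW ?mesh_gt0// sqr_edist.
have n0 : 0 < n.+1%:R :> R by [].
apply: (@le_lt_trans _ _ (\sum_(i < d) (n.+1%:R^-1 : R) ^+ 2)).
  apply: ler_sum => i _; rewrite -[leLHS]real_normK ?num_real//.
  rewrite ler_pXn2r ?nnegrE ?invr_ge0// -[leRHS]mul1r ler_pdivlMr//.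
  rewrite -[X in _ * X](gtr0_norm n0) -normrM mulrBl ler_norml.
  have /andP[x1 x2] := floor_itv ((tnth x i : R) * n.+1%:R).
  have /andP[y1 y2] := floor_itv ((tnth y i : R) * n.+1%:R).
  move: x1 x2; rewrite (h i) => x1 x2; move: y2 x2; rewrite intrD => y2 x2.
  by apply/andP; split; lra.
rewrite sumr_const card_ord -[ltLHS]mulr_natl /mesh expr_div_n -exprVn ltr_pM2r ?exprn_gt0 ?invr_gt0//.
by rewrite -natrX ltr_nat expnS expn1; nia.
Qed.

Lemma cell_pointP n k x : cell n k x -> cell n k (cell_point n k).
Proof. by move=> xk; apply: (@getPex _ (cell n k)); exists x. Qed.

Lemma edist_cell_point n k x : cell n k x -> edist x (cell_point n k) < mesh n.
Proof. by move=> xk; apply: edist_cell xk (cell_pointP xk). Qed.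

Lemma cell_sub_oball n k : cell n k `<=` oball (cell_point n k) (mesh n).
Proof. by move=> x /edist_cell_point. Qed.

Lemma cell_sub_eball0 n k : cell n k `<=` eball origin (edist (cell_point n k) origin + mesh n).
Proof. by apply: (subset_trans (@cell_sub_oball n k)); exact: oball_sub_eball0. Qed.

Lemma measurable_cell n k : measurable (cell n k).
Proof.
have [->|/set0P[x xk]] := eqVneq (cell n k) set0; first exact: measurable0.
rewrite (_ : cell n k = \bigcap_(i in [set: 'I_d]) [set y : Rvec R d |
  Num.floor ((tnth y i : R) * n.+1%:R) = Num.floor ((tnth x i : R) * n.+1%:R)]).
  apply: fin_bigcap_measurable => // i _.
  set m := Num.floor _.
  rewrite (_ : [set y | _] = [set y : Rvec R d | m%:~R <= (tnth y i : R) * n.+1%:R] `&`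
    [set y : Rvec R d | (tnth y i : R) * n.+1%:R < (m + 1)%:~R]).
    have mt : measurable_fun setT (fun y : Rvec R d => (tnth y i : R) * n.+1%:R).
      apply: measurable_funM; [exact: measurable_tnth | exact: measurable_cst].
    by apply: measurableI; [apply: measurable_set_le|apply: measurable_set_lt] => //; exact: measurable_cst.
  apply/seteqP; split => y /=.
    move=> <-; have /andP[] := floor_itv ((tnth y i : R) * n.+1%:R); by [].
  by move=> [y1 y2]; apply: floor_def; rewrite y1 y2.
apply/seteqP; split => y.
  by move=> yk i _; apply: (proj1 (cell_indexP n y x)); rewrite yk xk.
by move=> h; rewrite /cell /= -xk; apply/cell_indexP => i; exact: h.
Qed.

Lemma bigcup_cell n : \bigcup_k cell n k = setT.
Proof. by apply/seteqP; split => // x _; exists (cell_index n x). Qed.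

Lemma trivIset_cell n : trivIset setT (cell n).
Proof.
apply/trivIsetP => i j _ _ /eqP ij; apply/seteqP; split => x //=; rewrite /cell /=.
by move=> [xi xj]; apply: ij; rewrite -xi.
Qed.

End cells.
Arguments mesh {R} d n.

Section poisson.
Context {disp : measure_display} {T : measurableType disp} {R : realType}.
Context {P : probability T R} {d : nat} {lam : R} {Phi : T -> set (Rvec R d)}.
Hypothesis hPhi : poisson_process P lam Phi.
Local Notation mu := (lebesgue_measure_vec R d).
Implicit Types (B D : set (Rvec R d)).

Lemma count0E (w : T) B : (Phi w `&` B #= `I_0) = (Phi w `&` B = set0) :> Prop.
Proof. by rewrite II0 card_eq0; apply/propext; split => [/eqP|->]. Qed.

Lemma measurable_void B r : measurable B -> B `<=` eball origin r ->
  measurable [set w | Phi w `&` B = set0].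
Proof.
move=> mB Br; have := poisson_measurable_count hPhi 0 mB Br.
by congr measurable; apply/funext => w; exact: count0E.
Qed.

Lemma prob_void B r : 0 < lam -> measurable B -> B `<=` eball origin r ->
  P [set w | Phi w `&` B = set0] = (expR (- (lam * fine (mu B))))%:E.
Proof.
move=> lam0 mB Br.
rewrite (_ : [set w | _] = [set w | Phi w `&` B #= `I_0]); last first.
  by apply/funext => w; rewrite /mkset count0E.
rewrite (poisson_count hPhi 0 mB Br) /poisson_prob.
case: ifPn => h.
  by rewrite esum_set1 ?lee_fin ?poisson_pmf_ge0// /poisson_pmf h expr0 fact0 invr1 !mul1r.
have -> : lam * fine (mu B) = 0.
  by apply/eqP; rewrite eq_le leNgt h/= mulr_ge0 ?(ltW lam0)// fine_ge0.
by rewrite oppr0 expR0 diracE mem_set.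
Qed.

Lemma prob_count1 B r : 0 < lam -> measurable B -> B `<=` eball origin r ->
  P [set w | Phi w `&` B #= `I_1] =
  (lam * fine (mu B) * expR (- (lam * fine (mu B))))%:E.
Proof.
move=> lam0 mB Br; rewrite (poisson_count hPhi 1 mB Br) /poisson_prob.
case: ifPn => h.
  by rewrite esum_set1 ?lee_fin ?poisson_pmf_ge0// /poisson_pmf h expr1 invr1 mulr1.
have -> : lam * fine (mu B) = 0.
  by apply/eqP; rewrite eq_le leNgt h/= mulr_ge0 ?(ltW lam0)// fine_ge0.
by rewrite mul0r diracE memNset.
Qed.

Lemma prob_count1_void B D r : measurable B -> measurable D ->
  B `<=` eball origin r -> D `<=` eball origin r -> B `&` D = set0 ->
  P ([set w | Phi w `&` B #= `I_1] `&` [set w | Phi w `&` D = set0]) =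
  (P [set w | Phi w `&` B #= `I_1] * P [set w | Phi w `&` D = set0])%E.
Proof.
move=> mB mD Br Dr BD.
pose F (i : 'I_2) := if i == ord0 then B else D.
pose c (i : 'I_2) := if i == ord0 then 1%N else 0%N.
have := @poisson_independent _ _ _ _ _ _ _ hPhi 2 F r c.
have -> : \bigcap_i [set w | Phi w `&` F i #= `I_(c i)] =
    [set w | Phi w `&` B #= `I_1] `&` [set w | Phi w `&` D = set0].
  apply/seteqP; split => w.
    move=> h; split; first exact: (h ord0 I).
    by have := h (lift ord0 ord0) I; rewrite /F /c /= count0E.
  move=> [h1 h2] i _; rewrite /F /c; case: ifPn => // _.
  by rewrite /= count0E.
rewrite big_ord_recl big_ord_recl big_ord0 mule1 /F /c /=.
have -> : [set w | Phi w `&` D #= `I_0] = [set w | Phi w `&` D = set0].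
  by apply/funext => w; rewrite /mkset count0E.
apply.
- by move=> i; case: ifP.
- by move=> i; case: ifP.
- apply/trivIsetP => i j _ _.
  case: (unliftP ord0 i) => [i'|] ->; case: (unliftP ord0 j) => [j'|] -> //=.
  + by rewrite (ord1 i') (ord1 j') eqxx.
  + by rewrite setIC.
Qed.

End poisson.

Section joint_measurability.
Context {disp : measure_display} {T : measurableType disp} {R : realType}.
Context {P : probability T R} {d : nat} {lam : R} {Phi : T -> set (Rvec R d)}.
Hypothesis hPhi : poisson_process P lam Phi.
Context {dY : measure_display} {Y : measurableType dY}.

(** The condition at a point follows from a slightly stronger one at the reference
    point of its cube, by the Lipschitz bound, and the latter does not involve the
    outcome: the set is a countable union of rectangles. Graphs of Voronoi cells and
    void events of balls with a varying centre are complements of such sets. *)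
Lemma measurable_exists_point (C : R) (F : Rvec R d -> Y -> R) (D : set (Rvec R d)) :
  0 < C -> (forall x x' y, F x y <= F x' y + C * edist x x') ->
  (forall x, measurable_fun setT (F x)) -> measurable D ->
  measurable [set p : T * Y | exists x, [/\ Phi p.1 x, D x & F x p.2 < 0]].
Proof.
move=> C0 lipF mF mD.
pose W : nat -> nat -> set T := fun n k => ~` [set w | Phi w `&` (cell n k `&` D) = set0].
pose V : nat -> nat -> set Y := fun n k => [set y | F (cell_point n k) y + C * mesh d n < 0].
have -> : [set p : T * Y | exists x, [/\ Phi p.1 x, D x & F x p.2 < 0]] =
    \bigcup_n (\bigcup_k (W n k `*` V n k)).
  apply/seteqP; split => -[w y] /=.
    move=> [x [wx Dx Fxy]].
    have e0 : 0 < - F x y / (C *+ 2) by rewrite divr_gt0 ?oppr_gt0// mulrn_wgt0.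
    have /cvgr_lt /(_ _ e0) [n _ /(_ n (leqnn n)) hn] := @cvg_mesh R d.
    exists n => //; exists (cell_index n x) => //=; split.
      by apply/eqP/set0P; exists x.
    have xc : edist (cell_point n (cell_index n x)) x < mesh d n.
      by rewrite edistC; exact: edist_cell_point.
    have := lipF (cell_point n (cell_index n x)) x y => h.
    move: hn; rewrite ltr_pdivlMr ?mulrn_wgt0// => hn.
    have : C * edist (cell_point n (cell_index n x)) x < C * mesh d n by rewrite ltr_pM2l.
    by move: hn; rewrite mulrnAr mulrC mulr2n /V /=; lra.
  move=> [n _ [k _ [/eqP/set0P[x [wx [xk Dx]]] /= h]]].
  exists x; split => //; apply: le_lt_trans (lipF x (cell_point n k) y) _.
  apply: le_lt_trans h; rewrite lerD2l ler_pM2l// ltW//; exact: edist_cell_point.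
apply: bigcup_measurable => n _; apply: bigcup_measurable => k _.
apply: measurableX.
  apply: measurableC; apply: (measurable_void hPhi (r := edist (cell_point n k) origin + mesh d n)).
    by apply: measurableI => //; exact: measurable_cell.
  by move=> x [xk _]; exact: cell_sub_eball0 xk.
apply: measurable_set_lt; last exact: measurable_cst.
by apply: measurable_funD => //; exact: measurable_cst.
Qed.

End joint_measurability.

(** * Derivatives at the left end of a half-line *)

Section right_derivatives.
Context {R : realType}.
Implicit Types (f g F : R -> R) (l : R).
Local Notation A := (`[0, +oo[%classic : set R).

Lemma is_derive_quotient f (x l : R) : is_derive x 1 f l ->
  (f y - f x) / (y - x) @[y --> x^'] --> l.
Proof.
move=> [df <-]; apply/cvgrPdist_lt => e e0.
have /cvgrPdist_lt /(_ _ e0) [r /= r0 hr] : h^-1 *: ((f \o shift x) (h *: 1) - f x) @[h --> 0^'] --> 'D_1 f x.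
  exact: df.
exists r => //= y xy yx; have := hr (y - x).
rewrite /ball_ /= sub0r normrN distrC subr_eq0 => /(_ xy yx).
by rewrite /shift /= /GRing.scale /= mulr1 subrK mulrC.
Qed.

Lemma is_derive_exprn (n : nat) (x : R) :
  is_derive x 1 (fun y : R => y ^+ n) (n%:R * x ^+ n.-1).
Proof.
have := is_deriveX n (is_derive_id x 1); rewrite /GRing.scale /= mulr1.
by congr (is_derive _ _ _ _); apply/funext => y; rewrite !fctE.
Qed.

Lemma within_right_dnbhs0 : within A (dnbhs 0) = 0^'+.
Proof.
apply/seteqP; split => S [e /= e0 he]; exists e => //= y ye.
  by move=> y0; apply: he => //; rewrite ?gt_eqF//= in_itv/= andbT ltW.
by move=> y0; rewrite in_itv/= andbT => yge; apply: he => //; rewrite lt_def y0.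
Qed.

Lemma within_right_proper (x : R) : 0 <= x -> ProperFilter (within A (dnbhs x)).
Proof.
move=> x0; apply: Build_ProperFilter_ex => S [e /= e0 he].
exists (x + e / 2); apply: he => /=.
- by rewrite opprD addrA subrr sub0r normrN gtr0_norm ?divr_gt0// ltr_pdivrMr// ltr_pMr// ltr1n.
- by rewrite -subr_eq0 addrAC subrr add0r gt_eqF// divr_gt0.
- by rewrite in_itv/= andbT addr_ge0// ltW// divr_gt0.
Qed.

(** By induction the two (m-1)-st derivatives agree near [x] on the half-line, and the
    filter of punctured neighbourhoods there is proper. *)
Lemma is_derivn_within_uniq m F (x l l' : R) : 0 <= x ->
  is_derivn_within A m F x l -> is_derivn_within A m F x l' -> l = l'.
Proof.
elim: m F x l l' => [|m IH] F x l l' x0 /=; first by move=> <-.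
move=> [g [ng Hg]] [g' [ng' Hg']].
have E : \forall y \near within A (nbhs x), g y = g' y.
  rewrite near_withinE; move: ng ng'; rewrite !near_withinE => ng ng'.
  near=> y => Ay; apply: (IH F y).
  - by move: Ay; rewrite /= in_itv/= andbT.
  - by move: Ay; near: y.
  - by move: Ay; near: y.
have Ex : g x = g' x.
  move: E; rewrite near_withinE => /nbhs_singleton; apply.
  by rewrite /= in_itv/= andbT.
have pf := within_right_proper x0.
apply: (cvg_unique (@norm_hausdorff _ R) Hg).
apply: cvg_trans Hg'; apply: near_eq_cvg.
move: E; rewrite Ex !near_withinE => E.
near=> y => yx Ay; rewrite (_ : g' y = g y)//; apply/esym.
by move: Ay; near: y.
Unshelve. all: by end_near. Qed.

End right_derivatives.

Section euler_smooth.
Context {R : realType}.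
Implicit Types (f g F : R -> R) (l : R).

(** Regularity at [0+] measured with the Euler operator [f |-> x f'], which
    must be applicable [k] times and produce functions vanishing at [0+] after
    the first application. Unlike ordinary derivatives it is invariant under
    the substitution [x |-> x ^+ d], and it lets [x ^+ n * f x] be differentiated
    [n] times at [0] although [f] itself need not be differentiable there. *)
Fixpoint euler_smooth (k : nat) f l : Prop :=
  f x @[x --> 0^'+] --> l /\
  match k with
  | 0 => True
  | k'.+1 => exists g, (forall x : R, 0 < x -> is_derive x 1 f (g x / x)) /\
                       euler_smooth k' g 0
  end.

Lemma euler_smooth_cvg k f l : euler_smooth k f l -> f x @[x --> 0^'+] --> l.
Proof. by case: k => [|k] []. Qed.

Lemma euler_smoothW k f l : euler_smooth k.+1 f l -> euler_smooth k f l.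
Proof.
elim: k f l => [|k IH] f l; first by move=> [].
by move=> [fl [g [fg sg]]]; split => //; exists g; split => //; exact: IH.
Qed.

Lemma euler_smooth_cst k c : euler_smooth k (fun=> c) c.
Proof.
elim: k c => [|k IH] c; split => //; try exact: cvg_cst.
exists (fun=> 0); split => [x x0|]; last exact: IH.
by rewrite mul0r; exact: is_derive_cst.
Qed.

Lemma euler_smoothD k f g l m : euler_smooth k f l -> euler_smooth k g m ->
  euler_smooth k (fun x => f x + g x) (l + m).
Proof.
elim: k f g l m => [|k IH] f g l m [fl Hf] [gm Hg]; split => //; try exact: cvgD.
move: Hf Hg => [f' [ff' sf']] [g' [gg' sg']].
exists (fun x => f' x + g' x); split => [x x0|].
  by rewrite mulrDl; apply: is_deriveD; [exact: ff'|exact: gg'].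
by rewrite -[0]addr0; exact: IH.
Qed.

Lemma euler_smoothM k f g l m : euler_smooth k f l -> euler_smooth k g m ->
  euler_smooth k (fun x => f x * g x) (l * m).
Proof.
elim: k f g l m => [|k IH] f g l m; first by move=> [fl _] [gm _]; split => //; exact: cvgM.
move=> sf sg; have [fl [f' [ff' sf']]] := sf; have [gm [g' [gg' sg']]] := sg.
split; first exact: cvgM.
exists (fun x => f x * g' x + g x * f' x); split => [x x0|].
  have := is_deriveM (ff' x x0) (gg' x x0) => H; apply: is_derive_eq H _.
  by rewrite /GRing.scale /= mulrDl !mulrA addrC.
rewrite -[0](_ : l * 0 + m * 0 = 0); last by rewrite !mulr0 addr0.
by apply: euler_smoothD; apply: IH => //; exact: euler_smoothW.
Qed.

Lemma euler_smoothZ k c f l : euler_smooth k f l -> euler_smooth k (fun x => c * f x) (c * l).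
Proof. by apply: euler_smoothM; exact: euler_smooth_cst. Qed.

Lemma euler_smooth_id k : euler_smooth k id 0.
Proof.
elim: k => [|k IH]; split => //; try exact: cvg_at_right_filter cvg_id.
exists id; split => // x x0; rewrite divff ?gt_eqF//; exact: is_derive_id.
Qed.

(** The Euler operator sends [expR (- (c * s))] to [- c * s] times itself. *)
Lemma euler_smooth_expR k c : euler_smooth k (fun s => expR (- (c * s))) 1.
Proof.
have cv : expR (- (c * s)) @[s --> 0^'+] --> (1 : R).
  rewrite -[X in _ --> X](expR0 R) -[X in expR X]oppr0 -[X in - X](mulr0 c).
  apply: cvg_at_right_filter; apply: (continuous_comp (f := fun s => - (c * s))).
    by apply: continuousN; exact: mulrl_continuous.
  exact: continuous_expR.
elim: k => [|k IH]; split => //.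
exists (fun s => - c * (s * expR (- (c * s)))); split => [x x0|].
  rewrite mulrA mulrAC -(mulrA _ x) divff ?gt_eqF// mulr1.
  apply: is_derive_eq; rewrite /GRing.scale /=; ring.
rewrite -[0](_ : - c * (0 * 1) = 0); last by rewrite mul0r mulr0.
by apply: euler_smoothZ; apply: euler_smoothM => //; exact: euler_smooth_id.
Qed.

(** The quotient [q] satisfies [s q' = c * expR (- (c * s)) - q]. *)
Lemma euler_smooth_expRm1 k c : euler_smooth k (fun s => (1 - expR (- (c * s))) / s) c.
Proof.
have dE (x : R) : is_derive x 1 (fun s => expR (- (c * s))) (- c * expR (- (c * x))).
  by apply: is_derive_eq; rewrite /GRing.scale /=; ring.
have cv : (1 - expR (- (c * s))) / s @[s --> 0^'+] --> c.
  have /is_derive_quotient := dE 0.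
  rewrite mulr0 oppr0 expR0 mulr1 => /cvg_dnbhs_at_right /cvgN; rewrite opprK.
  apply: cvg_trans; apply: near_eq_cvg; near=> s.
  by rewrite !fctE addr0 -mulNr opprB.
elim: k => [|k IH]; split => //.
exists (fun s => - 1 * ((1 - expR (- (c * s))) / s) + c * expR (- (c * s))); split => [x x0|].
  have x00 : x != 0 by rewrite gt_eqF.
  have dN : is_derive x 1 (fun s => 1 - expR (- (c * s))) (c * expR (- (c * x))).
    by apply: is_derive_eq; rewrite /GRing.scale /=; ring.
  have dI : is_derive x 1 (fun s : R => s^-1) (- x ^- 2).
    have := @is_deriveV R id x 1 1 x00 (is_derive_id x 1) => H; apply: is_derive_eq H _.
    by rewrite /GRing.scale /= mulr1.
  have := is_deriveM dN dI => H; apply: is_derive_eq H _.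
  by rewrite /GRing.scale /=; field.
rewrite -[0](_ : - 1 * c + c * 1 = 0); last by rewrite mulN1r mulr1 addNr.
apply: euler_smoothD; apply: euler_smoothZ => //; exact: euler_smooth_expR.
Unshelve. all: by end_near. Qed.

Lemma cvg_exprn_right0 (d : nat) : (0 < d)%N -> (fun x : R => x ^+ d) x @[x --> 0^'+] --> 0^'+.
Proof.
move=> d0 S [e /= e0 he].
have /cvgrPdist_lt /(_ _ e0) H : (x ^+ d @[x --> 0^'+] --> (0 : R)).
  have {2}<- : 0 ^+ d = 0 :> R by rewrite expr0n gtn_eqF.
  by apply: cvg_at_right_filter; exact: exprn_continuous.
suff : \forall x \near 0^'+, S (x ^+ d) by [].
near=> x; apply: he => /=; last by rewrite exprn_gt0.
by near: x.
Unshelve. all: by end_near. Qed.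

Lemma euler_smooth_pow (d : nat) k f l : (0 < d)%N -> euler_smooth k f l ->
  euler_smooth k (fun x => f (x ^+ d)) l.
Proof.
move=> d0; elim: k f l => [|k IH] f l.
  by move=> [fl _]; split => //; apply: cvg_comp fl; exact: cvg_exprn_right0.
move=> [fl [g [fg sg]]]; split; first by apply: cvg_comp fl; exact: cvg_exprn_right0.
exists (fun x => d%:R * g (x ^+ d)); split => [x x0|]; last first.
  by rewrite -(mulr0 d%:R); apply: euler_smoothZ; exact: IH.
have x00 : x != 0 by rewrite gt_eqF.
have xd0 : 0 < x ^+ d by rewrite exprn_gt0.
have dX : is_derive x 1 (fun x : R => x ^+ d) (d%:R * x ^+ d.-1).
  exact: is_derive_exprn.
have := @is_derive1_comp R f (fun y => y ^+ d) x _ _ (fg _ xd0) dX => H; apply: is_derive_eq H _.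
rewrite -{2}(prednK d0) exprS; field.
by rewrite x00 expf_neq0.
Qed.

(** If [x f'] tends to [c] then, by the mean value theorem, [f (2 x) - f x]
    stays away from [0] unless [c = 0]. *)
Lemma cvg_euler_eq0 f g l c : (forall x : R, 0 < x -> is_derive x 1 f (g x / x)) ->
  f x @[x --> 0^'+] --> l -> g x @[x --> 0^'+] --> c -> c = 0.
Proof.
move=> fg fl gc; apply/eqP; apply/negPn/negP => c0.
have n0 : 0 < `|c| by rewrite normr_gt0.
have e0 : 0 < `|c| / 8 by rewrite divr_gt0.
have e1 : 0 < `|c| / 2 by rewrite divr_gt0.
move/cvgrPdist_lt : fl => /(_ _ e0) [r /= r0 hr].
move/cvgrPdist_lt : gc => /(_ _ e1) [s /= s0 hs].
pose m := Num.min r s / 4.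
have m0 : 0 < m by rewrite divr_gt0// lt_min r0.
have mr : 2 * m < r.
  have : Num.min r s <= r by rewrite ge_min lexx.
  by rewrite /m; lra.
have ms : 2 * m < s.
  have : Num.min r s <= s by rewrite ge_min lexx orbT.
  by rewrite /m; lra.
clearbody m.
have m2 : m < 2 * m by lra.
have dg x : x \in `]m, 2 * m[ -> is_derive x 1 f (g x / x).
  by rewrite in_itv/= => /andP[mx _]; apply: fg; exact: lt_trans mx.
have cf : {within `[m, 2 * m], continuous f}.
  apply: derivable_within_continuous => x; rewrite in_itv/= => /andP[mx _].
  by have [] := fg x (lt_le_trans m0 mx).
have [x] := MVT m2 dg cf; rewrite in_itv/= => /andP[mx xm] E.
have x0 : 0 < x := lt_trans m0 mx.
have h1 : `|l - f m| < `|c| / 8.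
  by apply: hr => //=; rewrite sub0r normrN gtr0_norm//; lra.
have h2 : `|l - f (2 * m)| < `|c| / 8.
  by apply: hr => /=; rewrite ?sub0r ?normrN ?gtr0_norm//; lra.
have h3 : `|c - g x| < `|c| / 2.
  by apply: hs => //=; rewrite sub0r normrN gtr0_norm//; lra.
have h4 : `|f (2 * m) - f m| < `|c| / 4.
  rewrite (_ : f (2 * m) - f m = (l - f m) - (l - f (2 * m))); last by ring.
  by apply: le_lt_trans (ler_normB _ _) _; lra.
have h5 : `|c| / 2 < `|g x|.
  have := ler_normD (c - g x) (g x); rewrite subrK; lra.
move: h4; rewrite E (_ : 2 * m - m = m); last by ring.
rewrite !normrM normfV (gtr0_norm x0) (gtr0_norm m0) => h4.
have : `|g x| * m < `|c| / 4 * x by rewrite -ltr_pdivrMr// mulrAC.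
have : `|c| / 2 * m < `|g x| * m by rewrite ltr_pM2r.
have : `|c| / 4 * x < `|c| / 4 * (2 * m) by rewrite ltr_pM2l// divr_gt0.
lra.
Qed.

(** If the [j]-th derivative is [y ^+ (n - j) * p y], the next one is
    [y ^+ (n - j.+1) * ((n - j) * p y + y * p' y)]: the Euler operator absorbs the
    factor [y] that is lost, and the limit of the second factor is multiplied
    by [n - j]. *)
Lemma derivn_within_step (n : nat) F f l : (0 < n)%N ->
  (forall x, 0 < x -> F x = x ^+ n * f x) -> F 0 = 0 -> euler_smooth n f l ->
  forall j, (j < n)%N -> exists p, euler_smooth (n - j) p ((n ^_ j)%:R * l) /\
    (forall y, 0 <= y -> is_derivn_within `[0, +oo[ j F y (y ^+ (n - j) * p y)).
Proof.
move=> n0 Ff F0 sf; elim=> [_|j IH jn].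
  exists f; rewrite subn0 ffactn0 mul1r; split => // y; rewrite le_eqVlt => /orP[/eqP<-|y0] /=.
    by rewrite F0 expr0n gtn_eqF// mul0r.
  exact: Ff.
have [p [sp Dp]] := IH (ltnW jn).
have nj : (n - j = (n - j.+1).+1)%N by rewrite subnSK ?(ltnW jn).
have [k kE] : exists k, (n - j.+1 = k.+1)%N by exists (n - j.+1).-1; rewrite prednK// subn_gt0.
move: sp; rewrite nj => -[pl [q [pq sq]]].
have spW : euler_smooth (n - j.+1) p ((n ^_ j)%:R * l).
  by apply: euler_smoothW; split => //; exists q.
exists (fun y => (n - j)%:R * p y + q y); split.
  rewrite (_ : _ * l = (n - j)%:R * ((n ^_ j)%:R * l) + 0); last first.
    by rewrite ffactnSr natrM addr0; ring.
  by apply: euler_smoothD => //; exact: euler_smoothZ.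
move=> y y0 /=; exists (fun z => z ^+ (n - j) * p z); split.
  by rewrite near_withinE; near=> z; rewrite /= in_itv/= andbT => z0; exact: Dp.
move: y0; rewrite le_eqVlt => /orP[/eqP<-|y0].
  have Z i : (0 : R) ^+ i.+1 = 0 by rewrite expr0n.
  rewrite within_right_dnbhs0 nj kE !Z !mul0r.
  have : z ^+ k.+1 * p z @[z --> 0^'+] --> 0 * ((n ^_ j)%:R * l).
    apply: cvgM => //; apply: cvg_at_right_filter.
    by rewrite -{2}(Z k); exact: exprn_continuous.
  rewrite mul0r; apply: cvg_trans; apply: near_eq_cvg; near=> z.
  have z0 : z != 0 by rewrite gt_eqF.
  by rewrite /= !subr0 [z ^+ k.+2]exprS; field.
apply: cvg_within_filter; apply: is_derive_quotient.
have dX : is_derive y 1 (fun x : R => x ^+ (n - j)) ((n - j)%:R * y ^+ (n - j.+1)).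
  by have := is_derive_exprn (n - j) y; rewrite nj.
have := is_deriveM dX (pq y y0) => H; apply: is_derive_eq H _.
rewrite /GRing.scale /= nj exprS; field.
by rewrite gt_eqF.
Unshelve. all: by end_near. Qed.

Lemma is_derivn_within_euler_smooth (n : nat) F f l : (0 < n)%N ->
  (forall x, 0 < x -> F x = x ^+ n * f x) -> F 0 = 0 -> euler_smooth n f l ->
  is_derivn_within `[0, +oo[ n F 0 (n`!%:R * l).
Proof.
move=> n0 Ff F0 sf.
have [|p [/euler_smooth_cvg pl Dp]] := derivn_within_step n0 Ff F0 sf (j := n.-1); first by rewrite prednK.
have E : (n - n.-1 = 1)%N by case: n n0 {Ff sf pl Dp} => // n _; rewrite subSnn.
rewrite -[X in is_derivn_within _ X](prednK n0) /=.
exists (fun z => z ^+ (n - n.-1) * p z); split.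
  by rewrite near_withinE; near=> z; rewrite /= in_itv/= andbT => z0; exact: Dp.
rewrite within_right_dnbhs0 E expr1 mul0r.
have <- : (n ^_ n.-1 = n`!)%N by rewrite -(ffactnn n) -[X in (_ = n ^_ X)%N](prednK n0) ffactnSr E muln1.
apply: cvg_trans pl; apply: near_eq_cvg; near=> z.
have z0 : z != 0 by rewrite gt_eqF.
by rewrite /= !subr0 expr1; field.
Unshelve. all: by end_near. Qed.

End euler_smooth.

(** * Laplace integrals near zero *)

Section laplace.
Context {dX : measure_display} {X : measurableType dX} {R : realType}.
Variables (m : {measure set X -> \bar R}) (D : set X) (u : X -> R).
Hypotheses (mD : measurable D) (mu : measurable_fun setT u) (u0 : forall x, 0 <= u x).
Hypothesis intu : forall s : R, 0 < s -> m.-integrable D (fun x => (expR (- (s * u x)))%:E).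

(** Up to sign the [k]-th derivative in [s] of the integral of
    [expR (- (s * u x))]. *)
Definition laplace (k : nat) (s : R) : R :=
  \int[m]_(x in D) (u x ^+ k * expR (- (s * u x))).

Lemma measurable_laplace_kernel k (s : R) :
  measurable_fun setT (fun x => u x ^+ k * expR (- (s * u x))).
Proof.
apply: measurable_funM; first exact: measurable_funX.
apply: measurableT_comp => //; apply: measurableT_comp => //.
by apply: measurable_funM => //; exact: measurable_cst.
Qed.

Lemma expr_le_expR (k : nat) (x : R) : 0 <= x -> x ^+ k <= k`!%:R * expR x.
Proof.
case: k => [|k] x0; first by rewrite expr0 mul1r -expR0 ler_expR.
rewrite -ler_pdivrMl ?ltr0n ?fact_gt0// mulrC.
by apply: le_trans (expR_ge1Dxn k x0); rewrite lerDr.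
Qed.

(** Half of the exponent absorbs the power of [u]. *)
Lemma integrable_laplace k (s : R) : 0 < s ->
  m.-integrable D (EFin \o (fun x => u x ^+ k * expR (- (s * u x)))).
Proof.
move=> s0; have s20 : 0 < s / 2 by rewrite divr_gt0.
pose c : R := k`!%:R / (s / 2) ^+ k.
apply: (le_integrable mD _ _ (integrableZl mD c (intu s20))).
  by apply/measurable_EFinP/measurable_funTS; exact: measurable_laplace_kernel.
move=> x _; rewrite [leRHS](_ : _ = (`|c * expR (- (s / 2 * u x))|)%:E)
  ?[leLHS](_ : _ = (`|u x ^+ k * expR (- (s * u x))|)%:E)// lee_fin.
have c0 : 0 <= c by rewrite divr_ge0// exprn_ge0// ltW.
rewrite !ger0_norm ?mulr_ge0 ?exprn_ge0 ?expR_ge0//.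
have -> : - (s * u x) = - (s / 2 * u x) + - (s / 2 * u x) by field.
rewrite expRD mulrA ler_wpM2r ?expR_ge0//.
have := @expr_le_expR k (s / 2 * u x) (mulr_ge0 (ltW s20) (u0 x)).
rewrite exprMn expRN /c => h.
  by rewrite ler_pdivrMr ?expR_gt0// mulrAC ler_pdivlMr ?exprn_gt0// mulrC.
by rewrite invr_ge0 exprn_ge0// ltW.
Qed.

Lemma is_derive_laplace k (s : R) : 0 < s -> is_derive s 1 (laplace k) (- laplace k.+1 s).
Proof.
move=> s0; have s20 : 0 < s / 2 by rewrite divr_gt0.
pose f (t : R) x := u x ^+ k * expR (- (t * u x)).
pose G x := u x ^+ k.+1 * expR (- (s / 2 * u x)).
have df (t : R) x : is_derive t 1 (f ^~ x) (- (u x ^+ k.+1 * expR (- (t * u x)))).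
  by apply: is_derive_eq; rewrite /GRing.scale /= exprS; ring.
have pE t x : partial1of2 f t x = - (u x ^+ k.+1 * expR (- (t * u x))).
  by rewrite partial1of2E; exact: derive_val.
have Is : `]s / 2, s * 2[%classic s.
  by rewrite /= in_itv/= ltr_pdivrMr// !ltr_pMr ?ltr1n.
have If t : `]s / 2, s * 2[%classic t -> m.-integrable D (EFin \o f t).
  by rewrite /= in_itv/= => /andP[t0 _]; apply: integrable_laplace; exact: lt_trans t0.
have dff t x : `]s / 2, s * 2[%classic t -> D x -> derivable (f ^~ x) t 1.
  by move=> _ _; have [] := df t x.
have G0 x : 0 <= G x by rewrite mulr_ge0 ?exprn_ge0 ?expR_ge0.
have IG : m.-integrable D (EFin \o G) by exact: integrable_laplace.
have ub t x : `]s / 2, s * 2[%classic t -> D x -> `|partial1of2 f t x| <= G x.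
  rewrite /= in_itv/= => /andP[t0 _] _; rewrite pE normrN ger0_norm ?mulr_ge0 ?exprn_ge0 ?expR_ge0//.
  by rewrite ler_wpM2l ?exprn_ge0// ler_expR lerN2 ler_wpM2r// ltW.
split; first exact: (derivable_under_integral mD Is If dff G0 IG ub).
rewrite -derive1E (differentiation_under_integral mD Is If dff G0 IG ub).
under eq_Rintegral do rewrite pE.
rewrite -[RHS]mulN1r -RintegralZl//; last exact: integrable_laplace.
by apply: eq_Rintegral => x _; rewrite mulN1r.
Qed.

Section euler.
Variables (a : nat) (ell : nat -> R).
Hypothesis cvg_ell : forall k, s ^+ (k + a) * laplace k s @[s --> 0^'+] --> ell k.

Let is_derive_scaled_laplace k (s : R) : 0 < s ->
  is_derive s 1 (fun t => t ^+ (k + a) * laplace k t)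
    (((k + a)%:R * (s ^+ (k + a) * laplace k s) - s ^+ (k.+1 + a) * laplace k.+1 s) / s).
Proof.
move=> s0; have := is_deriveM (is_derive_exprn (k + a) s) (is_derive_laplace k s0) => H.
apply: is_derive_eq H _; rewrite /GRing.scale /= addSn exprS.
case: (k + a)%N => [|n] /=; rewrite ?exprS; field; by rewrite gt_eqF.
Qed.

(** The Euler operator applied to the [k]-th rescaled function gives a combination
    of the [k]-th and the next one, which therefore has a limit; that limit cannot
    but vanish. *)
Let ellS k : (k + a)%:R * ell k - ell k.+1 = 0.
Proof.
apply: (cvg_euler_eq0 (is_derive_scaled_laplace k) (@cvg_ell k)).
by apply: cvgB => //; apply: cvgMr.
Qed.

(** Convergence of all the rescaled derivatives is the only thing to check: the
    Euler operator maps their linear span to itself. *)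
Lemma euler_smooth_laplace j k :
  euler_smooth j (fun s => s ^+ (k + a) * laplace k s) (ell k).
Proof.
elim: j k => [|j IH] k; split => //.
exists (fun s => (k + a)%:R * (s ^+ (k + a) * laplace k s)
                 + -1 * (s ^+ (k.+1 + a) * laplace k.+1 s)); split => [s s0|].
  by rewrite mulN1r; exact: is_derive_scaled_laplace.
rewrite -(ellS k) -(mulN1r (ell k.+1)).
by apply: euler_smoothD; apply: euler_smoothZ.
Qed.

End euler.
End laplace.

(** * Dilations and unions of two balls *)

Section integration_tools.
Context {R : realType}.

Lemma integral_sections d1 d2 (X : measurableType d1) (Y : measurableType d2)
    (m1 : {sigma_finite_measure set X -> \bar R})
    (m2 : {sigma_finite_measure set Y -> \bar R}) (S : set (X * Y)) :
  measurable S ->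
  (\int[m1]_x m2 (xsection S x) = \int[m2]_y m1 (ysection S y))%E.
Proof.
move=> mS; have := indic_fubini_tonelli m1 m2 mS.
have FE := indic_fubini_tonelli_FE m2 mS; have GE := indic_fubini_tonelli_GE m1 mS => E.
transitivity (\int[m1]_x fubini_F m2 (EFin \o \1_S) x)%E.
  by apply: eq_integral => x _; exact: (esym (congr1 (fun h => h x) FE)).
by rewrite E; apply: eq_integral => y _; exact: (congr1 (fun h => h y) GE).
Qed.

Lemma ge0_integral_prodX d1 d2 (X : measurableType d1) (Y : measurableType d2)
    (m1 : {sigma_finite_measure set X -> \bar R})
    (m2 : {sigma_finite_measure set Y -> \bar R}) (D : set X) (f : X * Y -> \bar R) :
  measurable D -> measurable_fun setT f -> (forall p, 0 <= f p)%E ->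
  (\int[m1 \x m2]_(p in D `*` setT) f p = \int[m1]_(x in D) \int[m2]_y f (x, y))%E.
Proof.
move=> mD mf f0; rewrite integral_mkcond [RHS]integral_mkcond.
have mDT : measurable (D `*` [set: Y]) by exact: measurableX.
rewrite fubini_tonelli1; last 2 first.
- apply/(measurable_restrictT _ mDT); exact: measurable_funTS.
- by move=> p; apply: erestrict_ge0.
apply: eq_integral => x _; rewrite /fubini_F /patch.
case: ifPn => xD.
  by apply: eq_integral => y _; rewrite mem_set//=; split => //; exact: set_mem.
rewrite integral0_eq// => y _; rewrite memNset//= => -[xD' _].
by move: xD; rewrite mem_set.
Qed.

Lemma measurable_integral_pair d1 d2 (X : measurableType d1) (Y : measurableType d2)
    (m2 : {sigma_finite_measure set Y -> \bar R}) (f : X * Y -> \bar R) :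
  measurable_fun setT f -> (forall p, 0 <= f p)%E ->
  measurable_fun setT (fun x => \int[m2]_y f (x, y))%E.
Proof. by move=> mf f0; exact: (@measurable_fun_fubini_tonelli_F _ _ _ _ R m2 f mf f0). Qed.

Lemma dominated_cvg_right dX (X : measurableType dX) (m : {measure set X -> \bar R})
    (D : set X) (F : R -> X -> R) (F0 G : X -> R) :
  measurable D -> (forall s, 0 < s -> measurable_fun setT (F s)) ->
  measurable_fun setT F0 ->
  (forall x, D x -> F s x @[s --> 0^'+] --> F0 x) ->
  (forall s x, 0 < s -> D x -> `|F s x| <= G x) ->
  m.-integrable D (EFin \o G) ->
  (\int[m]_(x in D) F s x)%R @[s --> 0^'+] --> (\int[m]_(x in D) F0 x)%R.
Proof.
move=> mD mF mF0 FF0 FG iG.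
apply/cvg_at_rightP => v [v0 cv].
have [] := @dominated_convergence _ X R m D mD (fun n x => (F (v n) x)%:E) (EFin \o F0) (EFin \o G).
- by move=> n; apply/measurable_EFinP/measurable_funTS/mF.
- by apply/measurable_EFinP/measurable_funTS.
- apply/aeW => x Dx; apply: cvg_EFin; first exact: nearW.
  by move/cvg_at_rightP : (FF0 x Dx); exact.
- by [].
- by apply/aeW => x n Dx; rewrite abse_EFin lee_fin; exact: FG.
move=> iF0 _ cF; apply: fine_cvg => /=; rewrite /Rintegral fineK//.
exact: integrable_fin_num.
Qed.

End integration_tools.

Section dilation.
Context {R : realType} {d : nat}.
Local Notation mu := (lebesgue_measure_vec R d).
Implicit Types (x y z : Rvec R d) (r : R).

Definition dil r x : Rvec R d := affine r origin x.

Lemma measurable_dil r : measurable_fun setT (dil r).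
Proof. exact: measurable_affine_vec. Qed.

Lemma dil_origin r : dil r origin = origin. Proof. exact: affine_origin. Qed.

Lemma edist_dil r x y : 0 < r -> edist (dil r x) (dil r y) = r * edist x y.
Proof. by move=> r0; rewrite edist_affine gtr0_norm. Qed.

Lemma norm_dil r x : 0 < r -> edist (dil r x) origin = r * edist x origin.
Proof. by move=> r0; rewrite -{1}(dil_origin r) edist_dil. Qed.

Lemma dilK r x : r != 0 -> dil r (dil r^-1 x) = x.
Proof.
move=> r0; apply: eq_from_tnth => i.
by rewrite !tnth_affine tnth_origin !addr0 mulVKf.
Qed.

Lemma integral_dil r (f : Rvec R d -> \bar R) : 0 < r ->
  measurable_fun setT f -> (forall x, 0 <= f x)%E ->
  (\int[mu]_x f x = (r ^+ d)%:E * \int[mu]_x f (dil r x))%E.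
Proof. by move=> r0 mf f0; rewrite (integral_vec_affine origin (lt0r_neq0 r0) mf f0) gtr0_norm. Qed.

Lemma integral_eball_dil r (f : Rvec R d -> \bar R) : 0 < r ->
  measurable_fun setT f -> (forall x, 0 <= f x)%E ->
  (\int[mu]_(x in eball origin r) f x =
   (r ^+ d)%:E * \int[mu]_(x in eball origin 1) f (dil r x))%E.
Proof.
move=> r0 mf f0; rewrite integral_mkcond [in RHS]integral_mkcond (integral_dil r0); last 2 first.
- apply/(measurable_restrictT _ (measurable_eball _ _)); exact: measurable_funTS.
- by move=> p; apply: erestrict_ge0.
congr (_ * _)%E; apply: eq_integral => x _; rewrite /patch.
have -> : (dil r x \in eball origin r) = (x \in eball origin 1) => //.
have E : eball origin r (dil r x) = eball origin 1 x.
  by rewrite /eball /mkset norm_dil//; have := ler_pM2l r0 (edist x origin) 1; rewrite mulr1 => ->.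
by apply/idP/idP; rewrite !inE E.
Qed.

End dilation.

Lemma measurable_mu_oballU {R : realType} {d : nat} dY (Y : measurableType dY)
    (a b : Y -> Rvec R d) (r s : Y -> R) :
  measurable_fun setT a -> measurable_fun setT b ->
  measurable_fun setT r -> measurable_fun setT s ->
  measurable_fun setT (fun q => fine (lebesgue_measure_vec R d
    (oball (a q) (r q) `|` oball (b q) (s q)))).
Proof.
move=> ma mb mr ms.
pose S : set (Y * Rvec R d) :=
  [set q | edist q.2 (a q.1) < r q.1] `|` [set q | edist q.2 (b q.1) < s q.1].
have mS : measurable S.
  apply: measurableU; apply: measurable_set_lt.
  - by apply: measurable_fun_edist; [exact: measurable_snd|exact: measurableT_comp ma measurable_fst].
  - exact: measurableT_comp mr measurable_fst.
  - by apply: measurable_fun_edist; [exact: measurable_snd|exact: measurableT_comp mb measurable_fst].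
  - exact: measurableT_comp ms measurable_fst.
rewrite (_ : (fun q => _) = fine \o (lebesgue_measure_vec R d \o xsection S)).
  by apply: measurableT_comp => //; exact: measurable_fun_xsection.
apply/funext => q /=; congr (fine (lebesgue_measure_vec R d _)).
by apply/seteqP; split => x; rewrite /xsection /= inE.
Qed.

Section two_balls.
Context {R : realType} {d : nat}.
Local Notation mu := (lebesgue_measure_vec R d).
Local Notation kap := (@unit_ball_volume R d).
Implicit Types (x y z : Rvec R d) (r : R) (p : Rvec R d * Rvec R d).

(** Both [p.1] and [p.2] lie in the cell of the origin exactly when no nucleus is
    in this set. *)
Definition two_balls p : set (Rvec R d) :=
  oball p.1 (edist p.1 origin) `|` oball p.2 (edist p.2 origin).

Definition two_balls_vol p : R := fine (mu (two_balls p)).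

Lemma measurable_two_balls p : measurable (two_balls p).
Proof. by apply: measurableU; exact: measurable_oball. Qed.

Lemma two_balls_sub p : two_balls p `<=`
  eball origin (2 * (edist p.1 origin + edist p.2 origin)).
Proof.
have H y z : oball y (edist y origin) `<=` eball origin (2 * (edist y origin + edist z origin)).
  move=> x xy; apply: le_trans (edist_triangle y x origin) _.
  by move: xy; rewrite /oball /=; have := edist_ge0 z origin; lra.
by move=> x [|]; [exact: H | rewrite addrC; exact: H].
Qed.

Hypothesis d0 : (0 < d)%N.

Lemma fin_num_two_balls p : mu (two_balls p) \is a fin_num.
Proof.
rewrite ge0_fin_numE//; apply: (@le_lt_trans _ _ (mu (eball origin (2 * (edist p.1 origin + edist p.2 origin))))).
  apply: le_measure; rewrite ?inE.
  - exact: measurable_two_balls.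
  - exact: measurable_eball.
  - exact: two_balls_sub.
by rewrite mu_eball ?ltry// mulr_ge0// addr_ge0 ?edist_ge0.
Qed.

Lemma two_balls_vol_ge0 p : 0 <= two_balls_vol p. Proof. exact: fine_ge0. Qed.

Lemma two_balls_vol_ge1 p : kap * edist p.1 origin ^+ d <= two_balls_vol p.
Proof.
rewrite -lee_fin -(mu_oball d0 p.1) ?edist_ge0// /two_balls_vol fineK ?fin_num_two_balls//.
apply: le_measure; rewrite ?inE; [exact: measurable_oball|exact: measurable_two_balls|].
by move=> x; left.
Qed.

Lemma two_balls_vol_ge2 p : kap * edist p.2 origin ^+ d <= two_balls_vol p.
Proof.
rewrite -lee_fin -(mu_oball d0 p.2) ?edist_ge0//.
rewrite /two_balls_vol fineK ?fin_num_two_balls//.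
apply: le_measure; rewrite ?inE; [exact: measurable_oball|exact: measurable_two_balls|].
by move=> x; right.
Qed.

Lemma two_balls_vol_le p : two_balls_vol p <= kap * edist p.1 origin ^+ d + kap * edist p.2 origin ^+ d.
Proof.
rewrite -lee_fin EFinD -(mu_oball d0 p.1) ?edist_ge0// -(mu_oball d0 p.2) ?edist_ge0//.
rewrite /two_balls_vol fineK ?fin_num_two_balls//.
by apply: measureU2; exact: measurable_oball.
Qed.

Lemma two_balls_vol_dil r p : 0 < r -> two_balls_vol (dil r p.1, dil r p.2) = r ^+ d * two_balls_vol p.
Proof.
move=> r0; rewrite /two_balls_vol (@measure_affine _ _ r origin) ?gt_eqF//; last exact: measurable_two_balls.
rewrite gtr0_norm// fineM//; last first.
  rewrite (_ : _ @^-1` _ = two_balls p) ?fin_num_two_balls//.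
  by apply/seteqP; split => x; rewrite /two_balls /oball /= -/(dil r x) !edist_dil// !norm_dil// !ltr_pM2l.
congr (_ * fine (mu _)).
by apply/seteqP; split => x; rewrite /two_balls /oball /= -/(dil r x) !edist_dil// !norm_dil// !ltr_pM2l.
Qed.

Lemma measurable_two_balls_vol : measurable_fun setT two_balls_vol.
Proof.
apply: measurable_mu_oballU; first exact: measurable_fst.
- exact: measurable_snd.
- by apply: measurable_fun_norm; exact: measurable_fst.
- by apply: measurable_fun_norm; exact: measurable_snd.
Qed.

End two_balls.

(** * Moments of the typical cell as functions of the radius *)

Section exp_integrability.
Context {R : realType} {d : nat}.
Local Notation mu := (lebesgue_measure_vec R d).
Local Notation kap := (@unit_ball_volume R d).
Implicit Types (x y z : Rvec R d) (r s : R) (p : Rvec R d * Rvec R d).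
Hypothesis d0 : (0 < d)%N.

Lemma measurable_exp_norm (c : R) :
  measurable_fun setT (fun y : Rvec R d => expR (- (c * edist y origin ^+ d))).
Proof.
apply: measurableT_comp => //; apply: measurableT_comp => //.
apply: measurable_funM; first exact: measurable_cst.
by apply: measurable_funX; apply: measurable_fun_norm; exact: measurable_id.
Qed.

Lemma integrable_exp_norm (c : R) : 0 < c ->
  mu.-integrable setT (fun y => (expR (- (c * edist y origin ^+ d)))%:E).
Proof.
move=> c0; apply/integrableP; split.
  by apply/measurable_EFinP; exact: measurable_exp_norm.
under eq_integral do rewrite abse_EFin ger0_norm ?expR_ge0//.
by rewrite integral_expRN_norm// ltry.
Qed.

Lemma integrable_exp_norm2 (c : R) : 0 < c -> (mu \x mu)%E.-integrable setT
  (fun p => (expR (- (c * edist p.1 origin ^+ d)) * expR (- (c * edist p.2 origin ^+ d)))%:E).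
Proof.
move=> c0.
have mf : measurable_fun setT (fun p : Rvec R d * Rvec R d =>
    (expR (- (c * edist p.1 origin ^+ d)) * expR (- (c * edist p.2 origin ^+ d)))%:E).
  apply/measurable_EFinP; apply: measurable_funM.
    exact: (measurableT_comp (measurable_exp_norm c) measurable_fst).
  exact: (measurableT_comp (measurable_exp_norm c) measurable_snd).
apply/integrableP; split => //.
under eq_integral do rewrite abse_EFin ger0_norm ?mulr_ge0 ?expR_ge0//.
rewrite fubini_tonelli1// /fubini_F /=.
rewrite (eq_integral (fun x => (kap / c)%:E * (expR (- (c * edist x origin ^+ d)))%:E)%E).
  rewrite ge0_integralZl_EFin//.
  - by rewrite integral_expRN_norm// -EFinM ltry.
  - by apply/measurable_EFinP; exact: measurable_exp_norm.
  - by rewrite divr_ge0 ?ltW// kap_gt0.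
move=> x _; rewrite muleC -(integral_expRN_norm d0 c0) -ge0_integralZl_EFin//.
by apply/measurable_EFinP; exact: measurable_exp_norm.
Qed.

Lemma integrable_exp_two_balls (s : R) : 0 < s ->
  (mu \x mu)%E.-integrable setT (fun p => (expR (- (s * two_balls_vol p)))%:E).
Proof.
move=> s0; have c0 : 0 < s * kap / 2 by rewrite divr_gt0// mulr_gt0// kap_gt0.
apply: (le_integrable measurableT _ _ (integrable_exp_norm2 c0)).
  apply/measurable_EFinP; apply: measurableT_comp => //; apply: measurableT_comp => //.
  by apply: measurable_funM; [exact: measurable_cst|exact: measurable_two_balls_vol].
move=> p _; rewrite !abse_EFin lee_fin !ger0_norm ?mulr_ge0 ?expR_ge0//.
rewrite -expRD ler_expR.
have h1 : s * (kap * edist p.1 origin ^+ d) <= s * two_balls_vol p by rewrite ler_pM2l// two_balls_vol_ge1.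
have h2 : s * (kap * edist p.2 origin ^+ d) <= s * two_balls_vol p by rewrite ler_pM2l// two_balls_vol_ge2.
move: h1 h2; rewrite !mulrA; lra.
Qed.

End exp_integrability.

Lemma cvg_exp_kernel {R : realType} {T : Type} (F : set_system T) (FF : Filter F)
    (k : nat) (g : T -> R) (l : R) : g x @[x --> F] --> l ->
  g x ^+ k * expR (- g x) @[x --> F] --> l ^+ k * expR (- l).
Proof.
move=> gl; apply: cvgM.
  exact: (@cvg_comp _ _ _ g (fun z : R => z ^+ k) _ _ _ gl (@exprn_continuous R k l)).
exact: (@cvg_comp _ _ _ (fun x => - g x) (@expR R) _ _ _ (cvgN gl) (@continuous_expR R (- l))).
Qed.

Section moment_functions.
Context {R : realType} {d : nat}.
Local Notation mu := (lebesgue_measure_vec R d).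
Local Notation kap := (@unit_ball_volume R d).
Implicit Types (x y z : Rvec R d) (r s : R) (p : Rvec R d * Rvec R d).
Hypothesis d0 : (0 < d)%N.
Variable lam : R.
Hypothesis lam0 : 0 < lam.

(** The integrand is the probability that [y] lies in the typical cell. *)
Definition mean_Z1 r : R :=
  \int[mu]_(y in eball origin r) expR (- (lam * (kap * edist y origin ^+ d))).
(** The integrand is the probability that both points lie in the typical cell. *)
Definition mean_Z1Z2 r : R :=
  \int[(mu \x mu)%E]_(p in eball origin r `*` setT) expR (- (lam * two_balls_vol p)).

Let u1 (y : Rvec R d) := lam * (kap * edist y origin ^+ d).
Let B : set (Rvec R d) := eball origin 1.

Let mB : measurable B. Proof. exact: measurable_eball. Qed.

Let mu1 : measurable_fun setT u1.
Proof.
apply: measurable_funM; first exact: measurable_cst.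
apply: measurable_funM; first exact: measurable_cst.
by apply: measurable_funX; apply: measurable_fun_norm; exact: measurable_id.
Qed.

Let u1_ge0 y : 0 <= u1 y.
Proof. by rewrite mulr_ge0 ?(ltW lam0)// mulr_ge0 ?exprn_ge0 ?edist_ge0 ?(ltW (@kap_gt0 R d)). Qed.

Let muB : mu B = kap%:E.
Proof. by rewrite mu_eball// expr1n mulr1. Qed.

Let integral_cstB (c : \bar R) : (\int[mu]_(y in B) c = c * kap%:E)%E.
Proof. by rewrite integral_cst//; congr (_ * _)%E; exact: muB. Qed.

Let integrable_cstB (c : R) : mu.-integrable B (fun=> c%:E).
Proof.
apply/integrableP; split; first exact: measurable_cst.
under eq_integral do rewrite abse_EFin.
by rewrite integral_cstB -EFinM ltry.
Qed.

Let intu1 s : 0 < s -> mu.-integrable B (fun y => (expR (- (s * u1 y)))%:E).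
Proof.
move=> s0; have c0 : 0 < s * (lam * kap) by rewrite !mulr_gt0// kap_gt0.
rewrite (_ : (fun y => _) = (fun y => (expR (- (s * (lam * kap) * edist y origin ^+ d)))%:E)).
  exact: (integrableS measurableT mB (@subsetT _ _) (integrable_exp_norm d0 c0)).
by apply/funext => y; congr (expR _)%:E; rewrite /u1; ring.
Qed.

(** After the dilation by [r] the ball is fixed and [r] enters only through
    [s = r ^+ d], in the exponent: a Laplace integral over the unit ball, whose value
    at [s = 0] is the volume of that ball. *)
Lemma euler_smooth_mean_Z1 : exists f : R -> R,
  (forall r, 0 < r -> mean_Z1 r = r ^+ d * f r) /\ (forall k, euler_smooth k f kap).
Proof.
pose ell k : R := if k is 0%N then kap else 0.
have cl k : s ^+ (k + 0) * laplace mu B u1 k s @[s --> 0^'+] --> ell k.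
  have <- : (\int[mu]_(y in B) (if k is 0%N then 1 else 0))%R = ell k.
    case: k => [|k]; rewrite /Rintegral.
      by rewrite integral_cstB mul1e.
    by rewrite integral0.
  have : (\int[mu]_(y in B) ((s * u1 y) ^+ k * expR (- (s * u1 y)))) @[s --> 0^'+] -->
     (\int[mu]_(y in B) (if k is 0%N then 1 else 0))%R.
    apply: (dominated_cvg_right (G := fun=> k`!%:R)) => //.
    - move=> s s0; have := measurable_laplace_kernel (measurable_funM (measurable_cst s) mu1) k 1.
      by under eq_fun do rewrite mul1r.
    - move=> y By.
      have -> : (if k is 0%N then 1 else 0) = (0 * u1 y) ^+ k * expR (- (0 * u1 y)).
        by rewrite mul0r oppr0 expR0 mulr1 expr0n; case: (k).
      apply: cvg_at_right_filter.
      have lin : z * u1 y @[z --> (0 : R)] --> 0 * u1 y by apply: cvgM; [exact: cvg_id|exact: cvg_cst].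
      exact: cvg_exp_kernel.
    - move=> s y s0 _; have h : 0 <= s * u1 y by rewrite (mulr_ge0 (ltW s0)).
      rewrite (ger0_norm (mulr_ge0 (exprn_ge0 k h) (expR_ge0 _))).
      by rewrite expRN ler_pdivrMr ?expR_gt0//; exact: expr_le_expR.
    - exact: integrable_cstB.
  apply: cvg_trans; apply: near_eq_cvg; near=> s.
  rewrite addn0 /laplace -RintegralZl//; last exact: integrable_laplace.
  by apply: eq_Rintegral => y _; rewrite exprMn mulrA.
exists (fun r => laplace mu B u1 0 (r ^+ d)); split; last first.
  move=> k; apply: euler_smooth_pow => //.
  have := euler_smooth_laplace mB mu1 u1_ge0 intu1 cl k 0.
  by under eq_fun do rewrite expr0 mul1r.
move=> r r0; rewrite /mean_Z1 /laplace /Rintegral.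
rewrite (integral_eball_dil r0); last 2 first.
- by apply/measurable_EFinP; apply: measurableT_comp => //; exact: measurableT_comp.
- by move=> y; rewrite lee_fin expR_ge0.
have E : (\int[mu]_(y in B) (u1 y ^+ 0 * expR (- (r ^+ d * u1 y)))%:E)%E \is a fin_num.
  apply: integrable_fin_num => //; apply: integrable_laplace => //.
  by rewrite exprn_gt0.
rewrite -[RHS]/(fine (r ^+ d)%:E * _) -fineM//; congr fine; congr (_ * _)%E.
apply: eq_integral => y _; rewrite expr0 mul1r norm_dil// exprMn /u1.
by congr (expR _)%:E; ring.
Unshelve. all: by end_near. Qed.

Let u2 p := lam * two_balls_vol p.
Let D : set (Rvec R d * Rvec R d) := B `*` setT.

Let mD : measurable D. Proof. exact: measurableX. Qed.

Let mu2 : measurable_fun setT u2.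
Proof. by apply: measurable_funM; [exact: measurable_cst|exact: measurable_two_balls_vol]. Qed.

Let u2_ge0 p : 0 <= u2 p.
Proof. by rewrite mulr_ge0 ?two_balls_vol_ge0// ltW. Qed.

Let intu2 s : 0 < s -> (mu \x mu)%E.-integrable D (fun p => (expR (- (s * u2 p)))%:E).
Proof.
move=> s0; have c0 : 0 < s * lam by rewrite mulr_gt0.
rewrite (_ : (fun p => _) = (fun p => (expR (- (s * lam * two_balls_vol p)))%:E)).
  exact: (integrableS measurableT mD (@subsetT _ _) (integrable_exp_two_balls d0 c0)).
by apply/funext => p; rewrite /u2 mulrA.
Qed.

Let root s : R := s `^ (d%:R^-1).

Let rootK s : 0 <= s -> root s ^+ d = s.
Proof.
by move=> s0; rewrite -powR_mulrn ?powR_ge0// -powRrM mulVf ?powRr1// pnatr_eq0 -lt0n.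
Qed.

Let root_gt0 s : 0 < s -> 0 < root s. Proof. exact: powR_gt0. Qed.

Let scaled s p := (dil (root s) p.1, p.2).

Let measurable_scaled s : measurable_fun setT (scaled s).
Proof.
apply: measurable_fun_pair; last exact: measurable_snd.
exact: measurableT_comp (measurable_dil _) measurable_fst.
Qed.

Let u2_scaled s p : 0 < s -> s * u2 (p.1, dil (root s)^-1 p.2) = u2 (scaled s p).
Proof.
move=> s0; have r0 := root_gt0 s0; rewrite /u2 mulrCA -{1}(rootK (ltW s0)) -two_balls_vol_dil//=.
by rewrite dilK// gt_eqF.
Qed.

(** Rescaling only the second point removes the parameter from the exponent
    except for the position of the first point, which tends to the origin. *)
Let scaled_laplaceE k s : 0 < s ->
  s ^+ (k + 1) * laplace (mu \x mu)%E D u2 k s =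
  (\int[(mu \x mu)%E]_(p in D) (u2 (scaled s p) ^+ k * expR (- u2 (scaled s p))))%R.
Proof.
move=> s0; have r0 := root_gt0 s0.
have rV0 : 0 < (root s)^-1 by rewrite invr_gt0.
have mK1 : measurable_fun setT (fun p => (u2 p ^+ k * expR (- (s * u2 p)))%:E).
  by apply/measurable_EFinP; exact: measurable_laplace_kernel.
have K1_ge0 p : (0 <= (u2 p ^+ k * expR (- (s * u2 p)))%:E)%E.
  by rewrite lee_fin (mulr_ge0 (exprn_ge0 k (u2_ge0 _)) (expR_ge0 _)).
have mK2 : measurable_fun setT (fun p => (u2 (scaled s p) ^+ k * expR (- u2 (scaled s p)))%:E).
  apply/measurable_EFinP.
  have := measurable_laplace_kernel mu2 k 1; under eq_fun do rewrite mul1r.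
  by move=> H; exact: (measurableT_comp H (measurable_scaled s)).
have K2_ge0 p : (0 <= (u2 (scaled s p) ^+ k * expR (- u2 (scaled s p)))%:E)%E.
  by rewrite lee_fin (mulr_ge0 (exprn_ge0 k (u2_ge0 _)) (expR_ge0 _)).
rewrite /laplace -RintegralZl//; last exact: integrable_laplace.
rewrite /Rintegral; congr fine.
under eq_integral do rewrite EFinM.
rewrite ge0_integralZl_EFin ?exprn_ge0 ?ltW//; last exact: measurable_funTS.
rewrite !ge0_integral_prodX//.
rewrite -ge0_integralZl_EFin ?exprn_ge0 ?ltW//; last 2 first.
- by move=> y _; apply: integral_ge0.
- apply: measurable_funTS; exact: (measurable_integral_pair mu mK1 K1_ge0).
apply: eq_integral => y _.
rewrite (integral_dil rV0); last 2 first.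
- exact: (measurableT_comp mK1 (measurable_pair1 y)).
- by move=> x; exact: K1_ge0.
rewrite muleA -EFinM exprVn rootK ?ltW// addn1 exprSr mulfK ?gt_eqF//.
rewrite -ge0_integralZl_EFin ?exprn_ge0 ?ltW//; last first.
  apply: (measurableT_comp mK1); apply: measurable_fun_pair; first exact: measurable_cst.
  exact: measurable_dil.
apply: eq_integral => x _; rewrite -EFinM mulrA -exprMn.
by have := u2_scaled (y, x) s0 => /= ->.
Qed.

Let ell2 k : R := (\int[(mu \x mu)%E]_(p in D) (u1 p.2 ^+ k * expR (- u1 p.2)))%R.

Let cvg_u2_scaled p : u2 (scaled s p) @[s --> 0^'+] --> u1 p.2.
Proof.
pose c := lam * (kap * edist p.1 origin ^+ d).
apply: (@squeeze_cvgr _ _ _ _ (fun=> u1 p.2) (fun s => s * c + u1 p.2)).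
- near=> s; have s0 : 0 < s by [].
  have r0 := root_gt0 s0.
  have := two_balls_vol_ge2 d0 (scaled s p) => /= h1.
  have := two_balls_vol_le d0 (scaled s p) => /=; rewrite norm_dil// exprMn rootK ?(ltW s0)// => h2.
  apply/andP; split; first by rewrite ler_pM2l.
  apply: (@le_trans _ _ (lam * (kap * (s * edist p.1 origin ^+ d) + kap * edist p.2 origin ^+ d))).
    by rewrite ler_pM2l.
  by rewrite le_eqVlt; apply/orP; left; apply/eqP; rewrite /u1 /c; ring.
- exact: cvg_cst.
- rewrite -[X in _ --> X]add0r; apply: cvgD; last exact: cvg_cst.
  rewrite -[X in _ --> X](mul0r c); apply: cvg_at_right_filter; exact: mulrr_continuous.
Unshelve. all: by end_near. Qed.

Let cvg_scaled_laplace k :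
  s ^+ (k + 1) * laplace (mu \x mu)%E D u2 k s @[s --> 0^'+] --> ell2 k.
Proof.
have : (\int[(mu \x mu)%E]_(p in D) (u2 (scaled s p) ^+ k * expR (- u2 (scaled s p))))%R
    @[s --> 0^'+] --> ell2 k.
  pose c := lam * kap / 2.
  have c0 : 0 < c by rewrite divr_gt0// mulr_gt0// kap_gt0.
  apply: (dominated_cvg_right
    (G := fun p => k`!%:R * 2 ^+ k * expR (- (c * edist p.2 origin ^+ d)))) => //.
  - move=> s s0; have := measurable_laplace_kernel mu2 k 1; under eq_fun do rewrite mul1r.
    by move=> H; exact: (measurableT_comp H (measurable_scaled s)).
  - have := measurable_laplace_kernel mu1 k 1; under eq_fun do rewrite mul1r.
    by move=> H; exact: (measurableT_comp H measurable_snd).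
  - by move=> p _; apply: cvg_exp_kernel; exact: cvg_u2_scaled.
  - move=> s p s0 _; set x := u2 _.
    have x0 : 0 <= x by exact: u2_ge0.
    rewrite (ger0_norm (mulr_ge0 (exprn_ge0 k x0) (expR_ge0 _))).
    have h := @expr_le_expR R k (x / 2) (divr_ge0 x0 (ler0n _ 2)).
    apply: (@le_trans _ _ (k`!%:R * 2 ^+ k * expR (- (x / 2)))).
      have -> : - x = - (x / 2) + - (x / 2) by field.
      rewrite expRD mulrA ler_wpM2r ?expR_ge0// expRN ler_pdivrMr ?expR_gt0//.
      by move: h; rewrite expr_div_n ler_pdivrMr ?exprn_gt0// mulrAC.
    rewrite ler_wpM2l ?mulr_ge0 ?exprn_ge0// ler_expR lerN2.
    have := two_balls_vol_ge2 d0 (scaled s p) => /= h1.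
    have : lam * (kap * edist p.2 origin ^+ d) <= x by rewrite ler_pM2l.
    by rewrite /c; lra.
  - apply: (@eq_integrable _ _ _ _ _ mD (fun p => (k`!%:R * 2 ^+ k)%:E * (expR (- (c * edist p.2 origin ^+ d)))%:E)%E).
      by move=> p _; rewrite -EFinM.
    apply: integrableZl => //; apply/integrableP; split.
      apply/measurable_EFinP/measurable_funTS.
      exact: (measurableT_comp (measurable_exp_norm c) measurable_snd).
    under eq_integral do rewrite abse_EFin ger0_norm ?expR_ge0//.
    rewrite ge0_integral_prodX//; last first.
      by apply/measurable_EFinP; exact: (measurableT_comp (measurable_exp_norm c) measurable_snd).
    under eq_integral do rewrite integral_expRN_norm//.
    by rewrite integral_cstB -EFinM ltry.
apply: cvg_trans; apply: near_eq_cvg; near=> s.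
by rewrite scaled_laplaceE.
Unshelve. all: by end_near. Qed.

Let ell2_0 : ell2 0 = kap / lam.
Proof.
rewrite /ell2 /Rintegral; under eq_integral do rewrite expr0 mul1r.
rewrite ge0_integral_prodX//; last first.
  apply/measurable_EFinP; apply: measurableT_comp => //; apply: measurableT_comp => //.
  exact: measurableT_comp mu1 measurable_snd.
rewrite /u1 /=; under eq_integral do under eq_integral do rewrite mulrA.
have k0 : 0 < kap by exact: kap_gt0.
under eq_integral do rewrite integral_expRN_norm ?mulr_gt0//.
rewrite integral_cstB -EFinM /=; field.
by rewrite !gt_eqF.
Qed.

(** Here the dilation acts on both points, whence an additional factor [r ^+ d] that
    compensates the divergence of the Laplace integral over the unbounded second
    point. In the limit the first point is at the origin and imposes no condition,
    so the integral over the second one is the mean volume of the typical cell. *)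
Lemma euler_smooth_mean_Z1Z2 : exists f : R -> R,
  (forall r, 0 < r -> mean_Z1Z2 r = r ^+ d * f r) /\
  (forall k, euler_smooth k f (kap / lam)).
Proof.
exists (fun r => (r ^+ d) ^+ (0 + 1) * laplace (mu \x mu)%E D u2 0 (r ^+ d)); split; last first.
  move=> k; rewrite -ell2_0.
  apply: (@euler_smooth_pow _ d k (fun s => s ^+ (0 + 1) * laplace (mu \x mu)%E D u2 0 s)) => //.
  exact: (euler_smooth_laplace mD mu2 u2_ge0 intu2 cvg_scaled_laplace k 0).
move=> r r0; rewrite add0n expr1.
have rd0 : 0 < r ^+ d by rewrite exprn_gt0.
have mE : measurable_fun setT (fun p => (expR (- u2 p))%:E).
  by apply/measurable_EFinP; apply: measurableT_comp => //; exact: measurableT_comp.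
have E_ge0 p : (0 <= (expR (- u2 p))%:E)%E by rewrite lee_fin expR_ge0.
have mF : measurable_fun setT (fun y : Rvec R d => \int[mu]_x (expR (- u2 (y, x)))%:E)%E.
  exact: (measurable_integral_pair mu mE E_ge0).
have fin : (\int[(mu \x mu)%E]_(p in D) (u2 p ^+ 0 * expR (- (r ^+ d * u2 p)))%:E)%E \is a fin_num.
  by apply: integrable_fin_num => //; exact: integrable_laplace.
rewrite mulrA /mean_Z1Z2 /laplace /Rintegral -[RHS]/(fine (r ^+ d * r ^+ d)%:E * _) -fineM//; congr fine.
rewrite (ge0_integral_prodX _ _ (measurable_eball _ _) mE)// (integral_eball_dil r0)//; last first.
  by move=> y; apply: integral_ge0.
rewrite EFinM -muleA; congr (_ * _)%E.
under [in RHS]eq_integral do rewrite expr0 mul1r.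
have mE2 : measurable_fun setT (fun p => (expR (- (r ^+ d * u2 p)))%:E).
  apply/measurable_EFinP; apply: measurableT_comp => //; apply: measurableT_comp => //.
  by apply: measurable_funM => //; exact: measurable_cst.
rewrite ge0_integral_prodX//.
rewrite -ge0_integralZl_EFin ?ltW//; last 2 first.
- by move=> y _; exact: integral_ge0.
- by apply: measurable_funTS; apply: (measurable_integral_pair mu mE2).
apply: eq_integral => y _; rewrite (integral_dil r0)//; last first.
  exact: (measurableT_comp mE (measurable_pair1 _)).
congr (_ * _)%E; apply: eq_integral => x _; rewrite /u2 (two_balls_vol_dil d0 (y, x))//.
by congr (expR _)%:E; ring.
Qed.

End moment_functions.
Arguments mean_Z1 {R} d lam r.
Arguments mean_Z1Z2 {R} d lam r.

(** * Moments of the typical cell as integrals *)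

Section voronoi_measurability.
Context {disp : measure_display} {T : measurableType disp} {R : realType}.
Context {P : probability T R} {d : nat} {lam : R} {Phi : T -> set (Rvec R d)}.
Hypothesis hPhi : poisson_process P lam Phi.
Implicit Types (x y : Rvec R d).

Lemma edistBl_lip x x' y : edist x y <= edist x' y + edist x x'.
Proof. by rewrite addrC; exact: edist_triangle. Qed.

Lemma measurable_voronoi_graph z :
  measurable [set q : T * Rvec R d | voronoi_cell (Phi q.1) z q.2].
Proof.
pose F x y : R := edist x y - edist y z.
rewrite (_ : [set q | _] = ~` [set q : T * Rvec R d | exists x, [/\ Phi q.1 x, setT x & F x q.2 < 0]]).
  apply: measurableC; apply: (measurable_exists_point hPhi (C := 1)) => //.
  - by move=> x x' y; rewrite /F mul1r addrAC lerD2r edistBl_lip.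
  - move=> x; apply: measurable_funB.
      by apply: measurable_fun_edist; [exact: measurable_cst|exact: measurable_id].
    by apply: measurable_fun_edist; [exact: measurable_id|exact: measurable_cst].
apply/seteqP; split => -[w y] /=.
  by move=> h [x [wx _]]; rewrite /F subr_lt0 ltNge h.
by move=> h x wx; rewrite leNgt; apply/negP => l; apply: h; exists x; rewrite /F subr_lt0.
Qed.

Lemma measurable_voronoi_cell w z : measurable (voronoi_cell (Phi w) z).
Proof.
have := measurable_xsection w (measurable_voronoi_graph z).
by congr measurable; apply/seteqP; split => y; rewrite /xsection /= inE.
Qed.

End voronoi_measurability.

Section typical_cell_moments.
Context {disp : measure_display} {T : measurableType disp} {R : realType}.
Context {P : probability T R} {d : nat} {lam : R} {Phi : T -> set (Rvec R d)}.
Hypothesis hPhi : poisson_process P lam Phi.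
Hypotheses (d0 : (0 < d)%N) (lam0 : 0 < lam).
Local Notation mu := (lebesgue_measure_vec R d).
Local Notation kap := (@unit_ball_volume R d).
Local Notation V w := (typical_cell (Phi w)).
Implicit Types (x y : Rvec R d) (p : Rvec R d * Rvec R d).

Lemma typical_cellP S y : typical_cell S y <-> S `&` oball y (edist y origin) = set0.
Proof.
split=> [h|h x Sx].
  by apply/seteqP; split => // x [Sx]; rewrite /oball /= ltNge h.
rewrite leNgt; apply/negP => l.
by have : (S `&` oball y (edist y origin)) x by []; rewrite h.
Qed.

Lemma prob_typical1 y :
  P [set w | V w y] = (expR (- (lam * (kap * edist y origin ^+ d))))%:E.
Proof.
have E : [set w | V w y] = [set w | Phi w `&` oball y (edist y origin) = set0].
  by apply/seteqP; split => w /=; move/typical_cellP.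
rewrite E (prob_void hPhi lam0 (measurable_oball _ _) (@oball_sub_eball0 _ _ _ _)).
by rewrite mu_oball ?edist_ge0.
Qed.

Lemma prob_typical2 p : P [set w | V w p.1 /\ V w p.2] = (expR (- (lam * two_balls_vol p)))%:E.
Proof.
have E : [set w | V w p.1 /\ V w p.2] = [set w | Phi w `&` two_balls p = set0].
  apply/seteqP; split => w /=; rewrite setIUr.
    by move=> [/typical_cellP -> /typical_cellP ->]; rewrite setU0.
  by rewrite setU_eq0 => -[h1 h2]; split; apply/typical_cellP.
by rewrite E (prob_void hPhi lam0 (measurable_two_balls _) (@two_balls_sub _ _ _)).
Qed.

Lemma measurable_typical_cell w : measurable (V w).
Proof. exact: (measurable_voronoi_cell hPhi). Qed.

Lemma measurable_typical_graph D : measurable D ->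
  measurable [set q : T * Rvec R d | D q.2 /\ V q.1 q.2].
Proof.
move=> mD; apply: measurableI; last exact: (measurable_voronoi_graph hPhi).
by rewrite -[X in measurable X]setTI; exact: measurable_snd.
Qed.

Lemma measurable_mu_cell D : measurable D -> measurable_fun setT (fun w => mu (D `&` V w)).
Proof.
move=> mD; have := measurable_fun_xsection mu (measurable_typical_graph mD).
congr measurable_fun; apply/funext => w /=; congr (mu _).
by apply/seteqP; split => y; rewrite /xsection /= inE.
Qed.

Lemma mean_mu_cell D : measurable D ->
  (\int[P]_w mu (D `&` V w) =
   \int[mu]_(y in D) (expR (- (lam * (kap * edist y origin ^+ d))))%:E)%E.
Proof.
move=> mD; have := integral_sections P mu (measurable_typical_graph mD).
rewrite (eq_integral (fun w => mu (D `&` V w))); last first.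
  move=> w _; congr (mu _).
  by apply/seteqP; split => y; rewrite /xsection /= inE.
move=> ->; rewrite [RHS]integral_mkcond; apply: eq_integral => y _; rewrite /patch.
case: ifPn => yD.
  rewrite -prob_typical1; congr (P _).
  by apply/seteqP; split => w; rewrite /ysection /= inE /=; [case|split => //; exact: set_mem].
rewrite (_ : ysection _ _ = set0) ?measure0//.
by apply/seteqP; split => w //; rewrite /ysection /= inE /= => -[yD' _]; move: yD; rewrite mem_set.
Qed.

(** A product of two volumes is the measure of a set of pairs of points; Fubini's
    theorem is applied one factor at a time. *)
Lemma mean_mu_cell2 D : measurable D ->
  (\int[P]_w (mu (D `&` V w) * mu (V w)) =
   \int[mu \x mu]_(p in D `*` setT) (expR (- (lam * two_balls_vol p)))%:E)%E.
Proof.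
move=> mD.
have mDV := measurable_typical_graph mD.
have mV : measurable [set q : T * Rvec R d | V q.1 q.2] by exact: (measurable_voronoi_graph hPhi).
pose S1 : set (T * Rvec R d) := [set q | D q.2 /\ V q.1 q.2].
have mh : measurable_fun setT (fun w => mu (V w)).
  by have := measurable_mu_cell measurableT; under eq_fun do rewrite setTI.
pose f (q : T * Rvec R d) : \bar R := ((\1_S1 q)%:E * mu (V q.1))%E.
have mf : measurable_fun setT f.
  apply: emeasurable_funM; first by apply/measurable_EFinP; exact: measurable_indic.
  exact: measurableT_comp mh measurable_fst.
have f0 q : (0 <= f q)%E by rewrite mule_ge0// lee_fin.
transitivity (\int[P]_w \int[mu]_y f (w, y))%E.
  apply: eq_integral => w _; rewrite /f.
  have mSw : measurable (D `&` V w) by apply: measurableI => //; exact: measurable_typical_cell.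
  rewrite (eq_integral (fun y => (\1_(D `&` V w) y)%:E * mu (V w))%E); last first.
    by move=> y _; rewrite !indicE; congr ((_%:R)%:E * _)%E; apply/idP/idP; rewrite !inE.
  rewrite ge0_integralZr//; last by apply/measurable_EFinP; exact: measurable_indic.
  by rewrite integral_indic// setIT.
rewrite (fubini_tonelli _ mf f0) ge0_integral_prodX//; last first.
  apply/measurable_EFinP; apply: measurableT_comp => //; apply: measurableT_comp => //.
  by apply: measurable_funM; [exact: measurable_cst|exact: measurable_two_balls_vol].
rewrite [RHS]integral_mkcond; apply: eq_integral => y _; rewrite /patch.
case: ifPn => yD; last first.
  rewrite integral0_eq// => w _; rewrite /f indicE memNset ?mul0e// => -[/= yD' _].
  by move: yD; rewrite mem_set.
pose S : set (T * Rvec R d) := [set q | V q.1 y /\ V q.1 q.2].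
have mS : measurable S.
  apply: measurableI => //.
  have m1 : measurable_fun setT (fun q : T * Rvec R d => (q.1, y)).
    by apply: measurable_fun_pair; [exact: measurable_fst|exact: measurable_cst].
  by have := m1 measurableT _ mV; rewrite setTI.
rewrite /fubini_G (eq_integral (fun w => mu (xsection S w))); last first.
  move=> w _; rewrite /f indicE; have [h|h] := pselect (V w y).
    rewrite mem_set ?mul1e; last by split => //; exact: set_mem.
    by congr (mu _); apply/seteqP; split => x; rewrite /xsection /= inE // => -[].
  rewrite memNset ?mul0e; last by case.
  rewrite (_ : xsection S w = set0) ?measure0//.
  by apply/seteqP; split => x //; rewrite /xsection /= inE => -[].
rewrite (integral_sections P mu mS); apply: eq_integral => x _.
rewrite -(prob_typical2 (y, x)); congr (P _).
by apply/seteqP; split => w; rewrite /ysection /= inE.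
Qed.

Lemma mean_mu_typical : (\int[P]_w mu (V w) = (lam^-1)%:E)%E.
Proof.
transitivity (\int[P]_w mu (setT `&` V w))%E; first by apply: eq_integral => w _; rewrite setTI.
rewrite mean_mu_cell//; have k0 : 0 < kap := kap_gt0.
under eq_integral do rewrite mulrA.
rewrite integral_expRN_norm ?mulr_gt0//; congr EFin; field.
by rewrite !gt_eqF.
Qed.

Lemma integrable_mu_typical : P.-integrable setT (fun w => mu (V w)).
Proof.
apply/integrableP; split.
  have := measurable_mu_cell measurableT.
  by under eq_fun do rewrite setTI.
under eq_integral do rewrite gee0_abs//.
by rewrite mean_mu_typical ltry.
Qed.

(** The integrable function [mu (V w)] is almost everywhere finite, so [fine] in [Z2]
    does not change integrals. *)
Lemma ae_fin_mu_typical : {ae P, forall w, mu (V w) = (Z2 Phi w)%:E}.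
Proof.
apply: filterS (integrable_ae measurableT integrable_mu_typical) => w /(_ I) h.
by rewrite /Z2 fineK.
Qed.

Lemma Z1E r w : 0 <= r -> (Z1 Phi r w)%:E = mu (eball origin r `&` V w).
Proof.
move=> r0; rewrite /Z1 fineK// ge0_fin_numE//.
apply: (@le_lt_trans _ _ (mu (eball (@origin R d) r))); last by rewrite mu_eball// ltry.
by apply: le_measure; rewrite ?inE;
  [apply: measurableI; [exact: measurable_eball|exact: measurable_typical_cell]
  |exact: measurable_eball|move=> x []].
Qed.

Lemma measurable_Z1 r : measurable_fun setT (Z1 Phi r).
Proof.
apply: (measurableT_comp (f := fine)) => //.
by apply: measurable_mu_cell; exact: measurable_eball.
Qed.

Lemma measurable_Z2 : measurable_fun setT (Z2 Phi).
Proof.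
apply: (measurableT_comp (f := fine)) => //.
have := measurable_mu_cell measurableT.
by under eq_fun do rewrite setTI.
Qed.

Lemma Z1_ge0 r w : 0 <= Z1 Phi r w. Proof. exact: fine_ge0. Qed.
Lemma Z2_ge0 w : 0 <= Z2 Phi w. Proof. exact: fine_ge0. Qed.

Lemma mean_Z2 : (\int[P]_w (Z2 Phi w)%:E = (lam^-1)%:E)%E.
Proof.
rewrite -mean_mu_typical; apply: ge0_ae_eq_integral => //.
- by apply/measurable_EFinP; exact: measurable_Z2.
- exact: measurable_int integrable_mu_typical.
- by move=> w _; rewrite lee_fin Z2_ge0.
- by apply: filterS ae_fin_mu_typical => w ->.
Qed.

Lemma int_exp_norm_eball r :
  mu.-integrable (eball origin r) (fun y => (expR (- (lam * (kap * edist y origin ^+ d))))%:E).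
Proof.
have c0 : 0 < lam * kap by rewrite mulr_gt0// kap_gt0.
rewrite (_ : (fun y => _) = (fun y => (expR (- (lam * kap * edist y origin ^+ d)))%:E)).
  exact: (integrableS measurableT (measurable_eball _ _) (@subsetT _ _) (integrable_exp_norm d0 c0)).
by apply/funext => y; rewrite mulrA.
Qed.

Lemma mean_Z1_E r : 0 <= r -> (\int[P]_w (Z1 Phi r w)%:E = (mean_Z1 d lam r)%:E)%E.
Proof.
move=> r0; under eq_integral do rewrite Z1E//.
rewrite mean_mu_cell; last exact: measurable_eball.
by rewrite /mean_Z1 /Rintegral fineK//; apply: integrable_fin_num (int_exp_norm_eball r); exact: measurable_eball.
Qed.

Let fin_U D : measurable D -> (\int[mu \x mu]_(p in D `*` setT) (expR (- (lam * two_balls_vol p)))%:E)%E \is a fin_num.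
Proof.
move=> mD; have mDT : measurable (D `*` [set: Rvec R d]) by exact: measurableX.
apply: integrable_fin_num => //.
exact: (integrableS measurableT mDT (@subsetT _ _) (integrable_exp_two_balls d0 lam0)).
Qed.

Lemma mean_Z1Z2_E r : 0 <= r ->
  (\int[P]_w (Z1 Phi r w * Z2 Phi w)%:E = (mean_Z1Z2 d lam r)%:E)%E.
Proof.
move=> r0; rewrite /mean_Z1Z2 /Rintegral fineK; last by apply: fin_U; exact: measurable_eball.
rewrite -mean_mu_cell2; last exact: measurable_eball.
apply: ge0_ae_eq_integral => //.
- by apply/measurable_EFinP; apply: measurable_funM; [exact: measurable_Z1|exact: measurable_Z2].
- apply: emeasurable_funM; first by apply: measurable_mu_cell; exact: measurable_eball.
  exact: measurable_int integrable_mu_typical.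
- by move=> w _; rewrite lee_fin mulr_ge0 ?Z1_ge0 ?Z2_ge0.
- by move=> w _; rewrite mule_ge0.
- by apply: filterS ae_fin_mu_typical => w -> _; rewrite EFinM Z1E.
Qed.

Definition mean_Z2sq : R := (\int[(mu \x mu)%E]_p expR (- (lam * two_balls_vol p)))%R.

Lemma mean_Z2sq_E : (\int[P]_w (Z2 Phi w * Z2 Phi w)%:E = mean_Z2sq%:E)%E.
Proof.
have := fin_U measurableT; rewrite setXTT => h.
rewrite /mean_Z2sq /Rintegral fineK// -setXTT -mean_mu_cell2//.
apply: ge0_ae_eq_integral => //.
- by apply/measurable_EFinP; apply: measurable_funM; exact: measurable_Z2.
- apply: emeasurable_funM; first exact: measurable_mu_cell.
  exact: measurable_int integrable_mu_typical.
- by move=> w _; rewrite lee_fin mulr_ge0 ?Z2_ge0.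
- by move=> w _; rewrite mule_ge0.
- by apply: filterS ae_fin_mu_typical => w h2 _; rewrite setTI h2 EFinM.
Qed.

Let Lfun1P (X : T -> R) (c : R) : measurable_fun setT X -> (forall w, 0 <= X w) ->
  (\int[P]_w (X w)%:E = c%:E)%E -> X \in Lfun P 1.
Proof.
move=> mX X0 EX; apply/Lfun1_integrable/integrableP; split; first exact/measurable_EFinP.
under eq_integral do rewrite abse_EFin ger0_norm//.
by rewrite EX ltry.
Qed.

Lemma GE r : 0 <= r ->
  G P Phi r = mean_Z1 d lam r * (2 * lam + lam ^+ 3 * (mean_Z2sq - lam^-1 ^+ 2))
              - mean_Z1Z2 d lam r * lam ^+ 2.
Proof.
move=> r0.
have L1 := Lfun1P (measurable_Z1 r) (Z1_ge0 r) (mean_Z1_E r0).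
have L2 := Lfun1P measurable_Z2 Z2_ge0 mean_Z2.
have L12 : (Z1 Phi r * Z2 Phi)%R \in Lfun P 1.
  apply: (Lfun1P (measurable_funM (measurable_Z1 r) measurable_Z2) _ (mean_Z1Z2_E r0)).
  by move=> w; rewrite mulr_ge0 ?Z1_ge0 ?Z2_ge0.
have L22 : (Z2 Phi * Z2 Phi)%R \in Lfun P 1.
  apply: (Lfun1P (measurable_funM measurable_Z2 measurable_Z2) _ mean_Z2sq_E).
  by move=> w; rewrite mulr_ge0 ?Z2_ge0.
have E1 : expectation P (Z1 Phi r) = (mean_Z1 d lam r)%:E by rewrite unlock mean_Z1_E.
have E2 : expectation P (Z2 Phi) = (lam^-1)%:E by rewrite unlock mean_Z2.
have E12 : expectation P (Z1 Phi r * Z2 Phi) = (mean_Z1Z2 d lam r)%:E by rewrite unlock mean_Z1Z2_E.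
have E22 : expectation P (Z2 Phi * Z2 Phi) = mean_Z2sq%:E by rewrite unlock mean_Z2sq_E.
rewrite /G /variance !covarianceE// E1 E2 E12 E22 -!EFinM -!EFinB /=.
by field; rewrite gt_eqF.
Qed.

End typical_cell_moments.
Arguments mean_Z2sq {R} d lam.

(** * Balls around a moving nearest nucleus *)

Section integral_monotone.
Context {d} {T : measurableType d} {R : realType}.
Local Open Scope ereal_scope.

(** The integral of a nonnegative function is a supremum over simple functions,
    so it is monotone even when the functions are not measurable: the volume of
    the zero cell depends on an arbitrary choice when two nuclei are at the same
    distance of the origin. *)
Lemma ge0_le_integralT (m : {measure set T -> \bar R}) (f g : T -> \bar R) :
  (forall w, 0 <= f w) -> (forall w, f w <= g w) ->
  \int[m]_w f w <= \int[m]_w g w.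
Proof.
move=> f0 fg; rewrite !ge0_integralTE//; last by move=> w; exact: le_trans (f0 w) (fg w).
apply: le_ereal_sup => _ [h hf <-]; exists h => // w.
exact: le_trans (hf w) (fg w).
Qed.

End integral_monotone.

Section shells.
Context {R : realType} {d : nat}.
Local Notation mu := (lebesgue_measure_vec R d).
Local Notation kap := (@unit_ball_volume R d).
Implicit Types (x y z c : Rvec R d) (h : R) (p : Rvec R d * Rvec R d).
Hypothesis d0 : (0 < d)%N.

(** For [h = 0] these are the points closer than [x] to the origin or to [y];
    if [x] is moved by at most [h], the balls for [- h] and for [h] bracket those
    of the moved point. *)
Definition shell h x y : set (Rvec R d) :=
  oball origin (edist x origin + h) `|` oball y (edist x y + h).

Definition shell_vol h p : R := fine (mu (shell h p.1 p.2)).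

Lemma measurable_shell h x y : measurable (shell h x y).
Proof. by apply: measurableU; exact: measurable_oball. Qed.

Lemma shell_bounded h x y : exists r, shell h x y `<=` eball origin r.
Proof.
exists (Num.max (edist x origin + h) (edist y origin + (edist x y + h))).
move=> z [|] hz.
  by rewrite /eball /= le_max (ltW hz).
by rewrite /eball /= le_max (oball_sub_eball0 hz) orbT.
Qed.

Lemma shell_subset h h' x y : h <= h' -> shell h x y `<=` shell h' x y.
Proof.
move=> hh z [|] hz; [left|right]; apply: oballWle hz; by rewrite lerD2l.
Qed.

Lemma shell_moved h e x c y : edist x c <= e -> shell h c y `<=` shell (h + e) x y.
Proof.
have tri z : edist c z <= edist x z + edist x c.
  by rewrite addrC (edistC x c); exact: edist_triangle.
move=> xc z [|] hz; [left|right]; apply: oballWle hz.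
- by have := tri origin; lra.
- by have := tri y; lra.
Qed.

Lemma fin_num_shell h x y : mu (shell h x y) \is a fin_num.
Proof.
have [r hr] := shell_bounded h x y; rewrite ge0_fin_numE//.
apply: (@le_lt_trans _ _ (mu (eball origin (Num.max r 0)))).
  apply: le_measure; rewrite ?inE; [exact: measurable_shell|exact: measurable_eball|].
  by move=> z /hr; rewrite /eball /= le_max => ->.
by rewrite mu_eball ?ltry// le_max lexx orbT.
Qed.

Lemma fine_mu_le (A B : set (Rvec R d)) : measurable A -> measurable B ->
  mu B \is a fin_num -> A `<=` B -> fine (mu A) <= fine (mu B).
Proof.
move=> mA mB Bfin AB.
have le : (mu A <= mu B)%E by apply: le_measure; rewrite ?inE.
rewrite fine_le// ge0_fin_numE//; apply: le_lt_trans le _.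
by rewrite -ge0_fin_numE.
Qed.

Lemma shell_vol_le h h' p : h <= h' -> shell_vol h p <= shell_vol h' p.
Proof.
move=> hh; apply: fine_mu_le; [exact: measurable_shell|exact: measurable_shell|exact: fin_num_shell|].
exact: shell_subset.
Qed.

Lemma measurable_shell_vol h : measurable_fun setT (shell_vol h).
Proof.
apply: measurable_mu_oballU; first exact: measurable_cst.
- exact: measurable_snd.
- apply: measurable_funD; last exact: measurable_cst.
  by apply: measurable_fun_norm; exact: measurable_fst.
- apply: measurable_funD; last exact: measurable_cst.
  by apply: measurable_fun_edist; [exact: measurable_fst|exact: measurable_snd].
Qed.

(* The volume of an open ball of possibly negative radius. *)
Let vol (r : R) : R := kap * Num.max r 0 ^+ d.

Let mu_oball_vol x r : mu (oball x r) = (vol r)%:E.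
Proof.
rewrite /vol; have [r0|r0] := leP 0 r; first by rewrite mu_oball.
rewrite expr0n gtn_eqF// mulr0 (_ : oball x r = set0) ?measure0//.
by apply/seteqP; split => y //=; rewrite /oball/= ltNge (le_trans (ltW r0)) ?edist_ge0.
Qed.

Let continuous_vol : continuous vol.
Proof.
move=> r; apply: cvgM; first exact: cvg_cst.
apply: (@cvg_comp _ _ _ (fun s : R => Num.max s 0) (fun s => s ^+ d)); last exact: exprn_continuous.
have E (s : R) : Num.max s 0 = (s + `|s|) / 2 by rewrite maxr_absE addr0 subr0.
rewrite E (_ : (fun s : R => Num.max s 0) = (fun s => (s + `|s|) / 2)); last exact/funext.
apply: cvgM; last exact: cvg_cst.
by apply: cvgD; [exact: cvg_id|exact: norm_continuous].
Qed.

(** Each of the two balls alone bounds the volume from below; half of each bound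
    goes into an integrable dominating function. *)
Lemma shell_vol_ge1 h p : vol (edist p.1 origin + h) <= shell_vol h p.
Proof.
rewrite -[vol _]/(fine (vol (edist p.1 origin + h))%:E) -(mu_oball_vol origin).
apply: fine_mu_le; [exact: measurable_oball|exact: measurable_shell|exact: fin_num_shell|].
by move=> z; left.
Qed.

Lemma shell_vol_ge2 h p : vol (edist p.1 p.2 + h) <= shell_vol h p.
Proof.
rewrite -[vol _]/(fine (vol (edist p.1 p.2 + h))%:E) -(mu_oball_vol p.2).
apply: fine_mu_le; [exact: measurable_oball|exact: measurable_shell|exact: fin_num_shell|].
by move=> z; right.
Qed.

(** The larger union is covered by the smaller one and two spherical shells. *)
Let shell_vol_growth h h' p : h <= h' ->
  shell_vol h' p - shell_vol h p <= (vol (edist p.1 origin + h') - vol (edist p.1 origin + h)) +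
                    (vol (edist p.1 p.2 + h') - vol (edist p.1 p.2 + h)).
Proof.
move=> hh.
have muD z r s : r <= s -> mu (oball z s `\` oball z r) = (vol s - vol r)%:E.
  move=> rs; rewrite measureD//=; [|exact: measurable_oball|exact: measurable_oball|].
    by rewrite setIidr ?mu_oball_vol//; exact: oballWle.
  by rewrite [ltLHS]mu_oball_vol ltry.
pose A : set (Rvec R d) := oball origin (edist p.1 origin + h') `\` oball origin (edist p.1 origin + h).
pose B := oball p.2 (edist p.1 p.2 + h') `\` oball p.2 (edist p.1 p.2 + h).
have mA : measurable A by apply: measurableD; exact: measurable_oball.
have mB : measurable B by apply: measurableD; exact: measurable_oball.
have mS := measurable_shell h p.1 p.2.
have sub : shell h' p.1 p.2 `<=` shell h p.1 p.2 `|` (A `|` B).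
  move=> z [|] hz.
    have [hz'|hz'] := pselect (oball origin (edist p.1 origin + h) z); first by left; left.
    by right; left.
  have [hz'|hz'] := pselect (oball p.2 (edist p.1 p.2 + h) z); first by left; right.
  by right; right.
have le : (mu (shell h' p.1 p.2) <= mu (shell h p.1 p.2) + (mu A + mu B))%E.
  apply: (@le_trans _ _ (mu (shell h p.1 p.2 `|` (A `|` B)))).
    apply: le_measure; rewrite ?inE//; first exact: measurable_shell.
    by apply: measurableU => //; exact: measurableU.
  apply: le_trans; first by apply: measureU2 => //; exact: measurableU.
  by apply: leeD => //; exact: measureU2.
rewrite lerBlDl -lee_fin !EFinD /shell_vol !fineK ?fin_num_shell//.
by move: le; rewrite /A /B !muD ?lerD2l.
Qed.

Lemma cvg_shell_vol (h : R^nat) p : h n @[n --> \oo] --> 0 -> shell_vol (h n) p @[n --> \oo] --> shell_vol 0 p.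
Proof.
move=> h0.
pose a := edist p.1 origin; pose b := edist p.1 p.2.
pose e (t : R) := `|vol (a + t) - vol (a + 0)| + `|vol (b + t) - vol (b + 0)|.
have le t : `|shell_vol t p - shell_vol 0 p| <= e t.
  rewrite /e; have [t0|t0] := leP 0 t.
    have := shell_vol_growth p t0; have := shell_vol_le p t0; rewrite -subr_ge0 => /ger0_norm ->.
    by move=> /le_trans; apply; apply: lerD; exact: ler_norm.
  have := shell_vol_growth p (ltW t0); have := shell_vol_le p (ltW t0); rewrite -subr_ge0 distrC => /ger0_norm ->.
  move=> /le_trans; apply; rewrite -/a -/b distrC [X in _ <= _ + X]distrC.
  by apply: lerD; exact: ler_norm.
have cv (x : R) : `|vol (x + h n) - vol (x + 0)| @[n --> \oo] --> 0.
  have c1 : x + h n @[n --> \oo] --> x + 0 by apply: cvgD => //; exact: cvg_cst.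
  have c2 : vol (x + h n) @[n --> \oo] --> vol (x + 0).
    exact: (@cvg_comp _ _ _ (fun n => x + h n) vol _ _ _ c1 (@continuous_vol (x + 0))).
  have c3 : vol (x + h n) - vol (x + 0) @[n --> \oo] --> 0 by apply/subr_cvg0.
  exact/norm_cvg0P.
have ce : e (h n) @[n --> \oo] --> 0 + 0 by apply: cvgD; exact: cv.
rewrite addr0 in ce.
apply/subr_cvg0; apply/norm_cvg0P.
apply: (squeeze_cvgr _ (cvg_cst 0) ce); apply: nearW => n.
by rewrite normr_ge0 le.
Qed.

Variable lam : R.
Hypothesis lam0 : 0 < lam.

Lemma measurable_exp_shell h : measurable_fun setT (fun p => (expR (- (lam * shell_vol h p)))%:E).
Proof.
apply/measurable_EFinP; apply: measurableT_comp => //; apply: measurableT_comp => //.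
by apply: measurable_funM; [exact: measurable_cst|exact: measurable_shell_vol].
Qed.

(** If [a >= 2 h] then [a - h >= a / 2]; for smaller [a] the constant factor
    compensates. *)
Let exp_vol_le (h a : R) : 0 <= h -> 0 <= a ->
  expR (- (lam / 2 * vol (a - h))) <=
  expR (lam / 2 * vol h) * expR (- (lam / 2 * kap / 2 ^+ d * a ^+ d)).
Proof.
move=> h0 a0; rewrite -expRD ler_expR /vol (max_l h0).
have k0 : 0 < kap := kap_gt0.
have c0 : 0 < lam / 2 * kap by rewrite !mulr_gt0// invr_gt0.
have -> : lam / 2 * kap / 2 ^+ d * a ^+ d = lam / 2 * kap * (a / 2) ^+ d.
  by rewrite expr_div_n; field; rewrite gt_eqF.
rewrite !mulrA; have [ah|ah] := leP a (2 * h).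
  have : lam / 2 * kap * (a / 2) ^+ d <= lam / 2 * kap * h ^+ d.
    by rewrite ler_pM2l// lerXn2r ?nnegrE ?divr_ge0// ler_pdivrMr// mulrC.
  have : 0 <= lam / 2 * kap * Num.max (a - h) 0 ^+ d.
    by rewrite (mulr_ge0 (ltW c0))// exprn_ge0// le_max lexx orbT.
  by lra.
have : lam / 2 * kap * (a / 2) ^+ d <= lam / 2 * kap * Num.max (a - h) 0 ^+ d.
  rewrite ler_pM2l// lerXn2r ?nnegrE ?divr_ge0 ?le_max ?lexx ?orbT//.
  by apply/orP; left; lra.
have : 0 <= lam / 2 * kap * h ^+ d by rewrite (mulr_ge0 (ltW c0))// exprn_ge0.
by lra.
Qed.

Lemma integral_exp_edist (c : R) x : 0 < c ->
  (\int[mu]_y (expR (- (c * edist x y ^+ d)))%:E = (kap / c)%:E)%E.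
Proof.
move=> c0; rewrite (integral_vec_affine x (oner_neq0 R)); last 2 first.
- apply/measurable_EFinP; apply: measurableT_comp => //; apply: measurableT_comp => //.
  apply: measurable_funM; first exact: measurable_cst.
  apply: measurable_funX; apply: measurable_fun_edist; [exact: measurable_cst|exact: measurable_id].
- by move=> y; rewrite lee_fin expR_ge0.
rewrite normr1 expr1n mul1e -(integral_expRN_norm d0 c0); apply: eq_integral => y _.
by rewrite -{1}(affine_origin 1 x) edist_affine normr1 mul1r edistC.
Qed.

Lemma integrable_exp_shift (c : R) : 0 < c -> (mu \x mu)%E.-integrable setT
  (fun p => (expR (- (c * edist p.1 origin ^+ d)) * expR (- (c * edist p.1 p.2 ^+ d)))%:E).
Proof.
move=> c0.
have m2 : measurable_fun setT (fun p : Rvec R d * Rvec R d => expR (- (c * edist p.1 p.2 ^+ d))).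
  apply: measurableT_comp => //; apply: measurableT_comp => //.
  apply: measurable_funM; first exact: measurable_cst.
  by apply: measurable_funX; apply: measurable_fun_edist; [exact: measurable_fst|exact: measurable_snd].
have mf : measurable_fun setT (fun p : Rvec R d * Rvec R d =>
    (expR (- (c * edist p.1 origin ^+ d)) * expR (- (c * edist p.1 p.2 ^+ d)))%:E).
  apply/measurable_EFinP; apply: measurable_funM => //.
  exact: (measurableT_comp (measurable_exp_norm c) measurable_fst).
apply/integrableP; split => //.
under eq_integral do rewrite abse_EFin ger0_norm ?mulr_ge0 ?expR_ge0//.
rewrite fubini_tonelli1// /fubini_F /=.
rewrite (eq_integral (fun x => (kap / c)%:E * (expR (- (c * edist x origin ^+ d)))%:E)%E).
  rewrite ge0_integralZl_EFin//.
  - by rewrite integral_expRN_norm// -EFinM ltry.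
  - by apply/measurable_EFinP; exact: measurable_exp_norm.
  - by rewrite divr_ge0 ?ltW// kap_gt0.
move=> x _; rewrite muleC -(integral_exp_edist x c0) -ge0_integralZl_EFin//.
by apply/measurable_EFinP; exact: (measurableT_comp m2 (measurable_pair1 x)).
Qed.

Lemma cvg_integral_exp_shell (h : R^nat) (h0 : R) : h n @[n --> \oo] --> 0 ->
  0 <= h0 -> (forall n, - h0 <= h n) ->
  (\int[mu \x mu]_p (expR (- (lam * shell_vol (h n) p)))%:E @[n --> \oo] -->
   \int[mu \x mu]_p (expR (- (lam * shell_vol 0 p)))%:E)%E.
Proof.
move=> hn h00 hh; have k0 : 0 < kap := kap_gt0.
pose c := lam / 2 * kap / 2 ^+ d.
have c0 : 0 < c by rewrite divr_gt0 ?exprn_gt0// !mulr_gt0// invr_gt0.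
pose C := expR (lam / 2 * vol h0).
have IG := integrableZl measurableT (C * C) (integrable_exp_shift c0).
have [] := @dominated_convergence _ _ R (mu \x mu)%E setT measurableT
  (fun n p => (expR (- (lam * shell_vol (h n) p)))%:E) (fun p => (expR (- (lam * shell_vol 0 p)))%:E) _ _ _ _ IG.
- by move=> n; exact: measurable_exp_shell.
- exact: measurable_exp_shell.
- apply/aeW => p _; apply: cvg_EFin; first exact: nearW.
  apply: (@cvg_comp _ _ _ (fun n => - (lam * shell_vol (h n) p)) (@expR R)); last exact: continuous_expR.
  by apply: cvgN; apply: cvgM; [exact: cvg_cst|exact: cvg_shell_vol].
- apply/aeW => p n _; rewrite abse_EFin ger0_norm ?expR_ge0// -EFinM lee_fin.
  apply: (@le_trans _ _ (expR (- (lam / 2 * vol (edist p.1 origin - h0))) *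
                         expR (- (lam / 2 * vol (edist p.1 p.2 - h0))))).
    rewrite -expRD ler_expR.
    have l1 : lam / 2 * vol (edist p.1 origin - h0) <= lam / 2 * shell_vol (h n) p.
      rewrite ler_pM2l ?divr_gt0//; apply: le_trans (shell_vol_ge1 _ _) _; exact: shell_vol_le.
    have l2 : lam / 2 * vol (edist p.1 p.2 - h0) <= lam / 2 * shell_vol (h n) p.
      rewrite ler_pM2l ?divr_gt0//; apply: le_trans (shell_vol_ge2 _ _) _; exact: shell_vol_le.
    by lra.
  have l1 := exp_vol_le h00 (edist_ge0 p.1 origin).
  have l2 := exp_vol_le h00 (edist_ge0 p.1 p.2).
  rewrite [leRHS]mulrACA.
  exact: (ler_pM (expR_ge0 _) (expR_ge0 _) l1 l2).
by [].
Qed.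

(** Stationarity: the translation by [- x] turns [shell 0 x y] into
    [two_balls (- x, y - x)]. *)
Lemma integral_exp_shell0 :
  (\int[mu \x mu]_p (expR (- (lam * shell_vol 0 p)))%:E =
   \int[mu \x mu]_p (expR (- (lam * two_balls_vol p)))%:E)%E.
Proof.
have mU : measurable_fun setT (fun p : Rvec R d * Rvec R d => (expR (- (lam * two_balls_vol p)))%:E).
  apply/measurable_EFinP; apply: measurableT_comp => //; apply: measurableT_comp => //.
  by apply: measurable_funM; [exact: measurable_cst|exact: measurable_two_balls_vol].
have U0 p : (0 <= (expR (- (lam * two_balls_vol p)))%:E)%E by rewrite lee_fin expR_ge0.
have W0 p : (0 <= (expR (- (lam * shell_vol 0 p)))%:E)%E by rewrite lee_fin expR_ge0.
rewrite (fubini_tonelli1 _ (measurable_exp_shell 0) W0) (fubini_tonelli1 _ mU U0) /fubini_F.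
have N1 : (-1 : R) != 0 by rewrite oppr_eq0 oner_neq0.
rewrite [RHS](integral_vec_affine origin N1); last 2 first.
- exact: (measurable_integral_pair mu mU U0).
- by move=> x; apply: integral_ge0 => y _; exact: U0.
rewrite normrN1 expr1n mul1e; apply: eq_integral => x _.
rewrite (integral_vec_affine x (oner_neq0 R)); last 2 first.
- exact: (measurableT_comp (measurable_exp_shell 0) (measurable_pair1 x)).
- by move=> y; rewrite lee_fin expR_ge0.
rewrite normr1 expr1n mul1e; apply: eq_integral => y _; congr (expR (- (lam * _)))%:E.
rewrite /shell_vol /two_balls_vol (@measure_affine _ _ 1 x) ?oner_neq0//; last exact: measurable_shell.
rewrite normr1 expr1n mul1e; congr (fine (mu _)).
have eN : edist (affine (-1) origin x) origin = edist x origin.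
  by have := edist_affine (-1) origin x origin; rewrite affine_origin normrN1 mul1r.
have aN : affine 1 x (affine (-1) origin x) = origin.
  by apply: eq_from_tnth => i; rewrite !tnth_affine tnth_origin; ring.
have eT z z' : edist (affine 1 x z) (affine 1 x z') = edist z z'.
  by rewrite edist_affine normr1 mul1r.
have e1 z : edist (affine 1 x z) origin = edist z (affine (-1) origin x) by rewrite -{1}aN eT.
have e3 : edist x (affine 1 x y) = edist y origin.
  by have := eT origin y; rewrite affine_origin (edistC origin).
by apply/funext => z; rewrite /shell /two_balls /oball /= !addr0 eN /setU /mkset /preimage /= e1 eT e3.
Qed.

End shells.

(** * The mean volume of the zero cell *)

Section nearest_nucleus.
Context {R : realType} {d : nat}.
Implicit Types (S : set (Rvec R d)).

Lemma exists_min_seq (T : eqType) (f : T -> R) (s : seq T) (x : T) : x \in s ->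
  exists2 y, y \in s & forall z, z \in s -> f y <= f z.
Proof.
elim: s x => // a s IH x _; case: s IH => [|b s] IH.
  by exists a => [|z]; rewrite inE// => /eqP ->.
have [y ys ymin] := IH b (mem_head b s).
have [ay|ya] := leP (f a) (f y).
  exists a => [|z]; rewrite inE ?eqxx// => /orP[/eqP ->//|/ymin]; exact: le_trans.
exists y => [|z]; rewrite in_cons; first by rewrite ys orbT.
by move=> /orP[/eqP ->|/ymin//]; exact: ltW.
Qed.

(** Local finiteness makes the distance to the origin attain its minimum, so the
    choice in [zero_cell] is never void when there is a nucleus. *)
Lemma exists_nearest S : (forall r : R, finite_set (S `&` eball origin r)) -> S !=set0 ->
  exists x, S x /\ voronoi_cell S x origin.
Proof.
move=> lf [x Sx].
have [s Es] := (finite_seqP _).1 (lf (edist x origin)).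
have xs : x \in s.
  have : (S `&` eball origin (edist x origin)) x by split => //; exact: lexx.
  by rewrite Es.
have [y ys ymin] := exists_min_seq (fun z => edist z origin) xs.
have [Sy yx] : (S `&` eball origin (edist x origin)) y by rewrite Es.
exists y; split => // z Sz; rewrite edistC.
have [zx|xz] := leP (edist z origin) (edist x origin).
  apply: ymin; have : (S `&` eball origin (edist x origin)) z by [].
  by rewrite Es.
exact: le_trans (ltW xz).
Qed.

End nearest_nucleus.

Section zero_cell_mean.
Context {disp : measure_display} {T : measurableType disp} {R : realType}.
Context {P : probability T R} {d : nat} {lam : R} {Phi : T -> set (Rvec R d)}.
Hypothesis hPhi : poisson_process P lam Phi.
Hypotheses (d0 : (0 < d)%N) (lam0 : 0 < lam).
Local Notation mu := (lebesgue_measure_vec R d).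
Local Notation kap := (@unit_ball_volume R d).
Implicit Types (x y : Rvec R d) (n k : nat).

Let Q n k : set (Rvec R d) := cell n k.
Let c n k : Rvec R d := cell_point n k.
Let q n k : R := fine (mu (Q n k)).

Let mQ n k : measurable (Q n k). Proof. exact: measurable_cell. Qed.

Let Q_sub_shell n k y : Q n k `<=` shell (mesh d n) (c n k) y.
Proof.
move=> x xk; left; rewrite /oball /=.
apply: le_lt_trans (edist_triangle (c n k) x origin) _.
by rewrite addrC ltrD2l; exact: edist_cell_point.
Qed.

Let muQ n k : mu (Q n k) = (q n k)%:E.
Proof.
rewrite /q fineK// ge0_fin_numE//.
apply: (@le_lt_trans _ _ (mu (shell (mesh d n) (c n k) origin))).
  apply: le_measure; rewrite ?inE; [exact: mQ|exact: measurable_shell|exact: Q_sub_shell].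
by rewrite -ge0_fin_numE// fin_num_shell.
Qed.

Let Qfin n k : mu (Q n k) \is a fin_num. Proof. by rewrite muQ. Qed.

Let measurable_void_shell h z (D : set (Rvec R d)) : measurable D ->
  measurable [set p : T * Rvec R d | Phi p.1 `&` (shell h z p.2 `&` D) = set0].
Proof.
move=> mD.
pose F1 x (y : Rvec R d) : R := edist x origin - (edist z origin + h).
pose F2 x (y : Rvec R d) : R := edist x y - (edist z y + h).
rewrite (_ : [set p | _] = ~` ([set p : T * Rvec R d | exists x, [/\ Phi p.1 x, D x & F1 x p.2 < 0]] `|`
                             [set p : T * Rvec R d | exists x, [/\ Phi p.1 x, D x & F2 x p.2 < 0]])).
  apply: measurableC; apply: measurableU.
  - apply: (measurable_exists_point hPhi (C := 1)) => //.
    + by move=> x x' y; rewrite /F1 mul1r addrAC lerD2r edistBl_lip.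
    + by move=> x; exact: measurable_cst.
  - apply: (measurable_exists_point hPhi (C := 1)) => //.
    + by move=> x x' y; rewrite /F2 mul1r addrAC lerD2r edistBl_lip.
    + move=> x; apply: measurable_funB.
        by apply: measurable_fun_edist; [exact: measurable_cst|exact: measurable_id].
      apply: measurable_funD; last exact: measurable_cst.
      by apply: measurable_fun_edist; [exact: measurable_cst|exact: measurable_id].
apply/seteqP; split => -[w y] /=.
  move=> E; rewrite not_orP; split => -[x [wx Dx l]].
    have : (Phi w `&` (shell h z y `&` D)) x.
      by split => //; split => //; left; move: l; rewrite /F1 subr_lt0.
    by rewrite E.
  have : (Phi w `&` (shell h z y `&` D)) x.
    by split => //; split => //; right; move: l; rewrite /F2 subr_lt0.
  by rewrite E.
rewrite not_orP => -[h1 h2]; apply/seteqP; split => // x [wx [[l|l] Dx]].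
  by apply: h1; exists x; split => //; rewrite /F1 subr_lt0.
by apply: h2; exists x; split => //; rewrite /F2 subr_lt0.
Qed.

Let measurable_count_strip n k (j : nat) : measurable [set p : T * Rvec R d | Phi p.1 `&` Q n k #= `I_j].
Proof.
have m := poisson_measurable_count hPhi j (mQ n k) (@cell_sub_eball0 R d n k).
by rewrite -[X in measurable X]setTI; exact: (measurable_fst measurableT _ m).
Qed.

(** ** Lower bound: events that imply that the nearest nucleus is in a cell *)

(* Every nucleus other than the one in the cube is farther than it, both from the
   origin and from [y]: that nucleus is the one of the zero cell, and [y] belongs to
   its cell. *)
Let low n k : set (T * Rvec R d) := [set p | Phi p.1 `&` Q n k #= `I_1 /\
  Phi p.1 `&` (shell (mesh d n) (c n k) p.2 `\` Q n k) = set0].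

Let measurable_low n k : measurable (low n k).
Proof.
apply: measurableI; first exact: measurable_count_strip.
by have := @measurable_void_shell (mesh d n) (c n k) (~` Q n k) (measurableC (mQ n k)).
Qed.

Let lowP w y n k : low n k (w, y) -> exists x0, [/\ Phi w x0, Q n k x0 &
  forall x, Phi w x -> x <> x0 -> ~ Q n k x /\
    edist x0 origin < edist x origin /\ edist x0 y < edist x y].
Proof.
move=> [/= /eq_cardSP[x0 [wx0 Qx0]]]; rewrite -/(Phi w) => h1 h2.
have {}h1 : (Phi w `&` Q n k) `\ x0 = set0 by move: h1; rewrite II0 card_eq0 => /eqP.
exists x0; split => // x wx xx0.
have nQ : ~ Q n k x.
  by move=> Qx; have : ((Phi w `&` Q n k) `\ x0) x by []; rewrite h1.
have nsh : ~ shell (mesh d n) (c n k) y x.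
  by move=> sh; have : (Phi w `&` (shell (mesh d n) (c n k) y `\` Q n k)) x by []; rewrite h2.
have hx0 : edist x0 (c n k) < mesh d n by exact: edist_cell_point.
split => //; split.
  rewrite ltNge; apply/negP => le; apply: nsh; left; rewrite /oball /=.
  by apply: (le_lt_trans le); have := edist_triangle (c n k) x0 origin; lra.
rewrite ltNge; apply/negP => le; apply: nsh; right; rewrite /oball /=.
by apply: (le_lt_trans le); have := edist_triangle (c n k) x0 y; lra.
Qed.

Let low_zero_cell w y n k : low n k (w, y) -> zero_cell (Phi w) y.
Proof.
move=> /lowP[x0 [wx0 Qx0 near]].
have -> : zero_cell (Phi w) = voronoi_cell (Phi w) x0.
  congr voronoi_cell; apply: get_unique.
    split => // x wx; rewrite edistC.
    have [->//|/eqP xx0] := eqVneq x x0.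
    by have [_ [/ltW]] := near x wx xx0.
  move=> x [wx vx]; apply: contrapT => xx0.
  have [_ [l _]] := near x wx xx0.
  by have := vx _ wx0; rewrite edistC leNgt l.
move=> x wx; rewrite edistC; have [->//|/eqP xx0] := eqVneq x x0.
by have [_ [_ /ltW]] := near x wx xx0.
Qed.

Let trivIset_low n : trivIset setT (low n).
Proof.
apply/trivIsetP => i j _ _ /eqP ij; apply/seteqP; split => // -[w y] [].
move=> /lowP[x [wx Qx nx]] /lowP[z [wz Qz nz]].
have xz : x <> z by move=> E; apply: ij; rewrite -Qx -Qz E.
have [_ [l1 _]] := nx z wz (fun E => xz (esym E)).
have [_ [l2 _]] := nz x wx xz.
by move: (lt_trans l1 l2); rewrite ltxx.
Qed.

(** The cube lies in the shell, so by independence the two void probabilities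
    multiply to that of the shell. *)
Let prob_low n k y : P (ysection (low n k) y) =
  (lam * q n k * expR (- (lam * fine (mu (shell (mesh d n) (c n k) y)))))%:E.
Proof.
have -> : ysection (low n k) y = [set w | Phi w `&` Q n k #= `I_1] `&`
    [set w | Phi w `&` (shell (mesh d n) (c n k) y `\` Q n k) = set0].
  by apply/seteqP; split => w; rewrite /ysection /= inE.
have [r hr] := shell_bounded (mesh d n) (c n k) y.
have msh := measurable_shell (mesh d n) (c n k) y.
have Qr : Q n k `<=` eball origin r by exact: subset_trans (@Q_sub_shell n k y) hr.
have Dr : shell (mesh d n) (c n k) y `\` Q n k `<=` eball origin r by move=> x [/hr].
have mD : measurable (shell (mesh d n) (c n k) y `\` Q n k) by exact: measurableD.
rewrite (prob_count1_void hPhi (mQ n k) mD Qr Dr); last exact: setDIK.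
rewrite (prob_count1 hPhi lam0 (mQ n k) Qr) (prob_void hPhi lam0 mD Dr) -EFinM.
rewrite measureD//; last by rewrite -ge0_fin_numE// fin_num_shell.
rewrite setIidr; last exact: Q_sub_shell.
rewrite fineB ?fin_num_shell//; last exact: Qfin.
congr EFin; rewrite -[LHS]mulrA -expRD; congr (_ * expR _); rewrite /q; ring.
Qed.

Let e_shell (h : R) y x : \bar R := (expR (- (lam * shell_vol h (x, y))))%:E.

Let m_e_shell h y : measurable_fun setT (e_shell h y).
Proof. exact: (measurableT_comp (measurable_exp_shell lam h) (measurable_pair2 y)). Qed.

Let m_integral_e_shell (h : R) : measurable_fun setT (fun y => \int[mu]_x (lam%:E * e_shell h y x))%E.
Proof.
pose f (p : Rvec R d * Rvec R d) : \bar R := (lam%:E * e_shell h p.1 p.2)%E.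
have mf : measurable_fun setT f.
  apply: emeasurable_funM; first exact: measurable_cst.
  have := measurableT_comp (measurable_exp_shell lam h) (@measurable_swap _ _ (Rvec R d) (Rvec R d)).
  by congr measurable_fun; apply/funext => -[].
by apply: (measurable_integral_pair mu mf) => p; rewrite mule_ge0// lee_fin ?expR_ge0 ?ltW.
Qed.

Let integral_low n k y :
  (\int[mu]_(x in Q n k) (lam%:E * e_shell (mesh d n + mesh d n) y x) <= P (ysection (low n k) y))%E.
Proof.
pose b := lam * expR (- (lam * fine (mu (shell (mesh d n) (c n k) y)))).
have Eb : (lam * q n k * expR (- (lam * fine (mu (shell (mesh d n) (c n k) y)))))%:E =
    (b%:E * mu (Q n k))%E.
  by rewrite muQ -EFinM /b; congr EFin; ring.
rewrite prob_low Eb.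
rewrite -integral_cst//; apply: ge0_le_integral => //.
- by move=> x _; rewrite mule_ge0// lee_fin ?expR_ge0 ?ltW.
- by apply: measurable_funTS; apply: emeasurable_funM => //; exact: measurable_cst.
move=> x Qx; rewrite -EFinM lee_fin ler_pM2l// ler_expR lerN2 ler_pM2l//.
apply: fine_mu_le; [exact: measurable_shell|exact: measurable_shell|exact: fin_num_shell|].
by apply: shell_moved; apply: ltW; exact: edist_cell_point.
Qed.

(** ** Upper bound: events that cover the zero cell *)

(* This holds for the cube that contains the nucleus of the zero cell, whenever [y]
   is in that cell. *)
Let up n k : set (T * Rvec R d) := [set p | Phi p.1 `&` Q n k <> set0 /\
  Phi p.1 `&` shell (- mesh d n) (c n k) p.2 = set0].

Let measurable_up n k : measurable (up n k).
Proof.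
have -> : up n k = ~` [set p : T * Rvec R d | Phi p.1 `&` Q n k #= `I_0] `&`
    [set p : T * Rvec R d | Phi p.1 `&` (shell (- mesh d n) (c n k) p.2 `&` setT) = set0].
  by apply/seteqP; split => p /=; rewrite setIT -/(Phi p.1) count0E.
apply: measurableI; last exact: measurable_void_shell.
by apply: measurableC; exact: measurable_count_strip.
Qed.

Let zero_cell_up n w y : Phi w !=set0 -> zero_cell (Phi w) y -> exists k, up n k (w, y).
Proof.
move=> w0 zy; have ex := exists_nearest (poisson_locally_finite hPhi w) w0.
have := getPex ex; set x0 := get _ => -[wx0 vx0].
exists (cell_index n x0); split => /=.
  by move=> E; have : (Phi w `&` Q n (cell_index n x0)) x0 by []; rewrite E.
have cx : edist x0 (c n (cell_index n x0)) < mesh d n by exact: edist_cell_point.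
apply/seteqP; split => // x [wx]; rewrite /shell /oball /= => -[l|l].
  have := vx0 x wx; have := edist_triangle x0 (c n (cell_index n x0)) origin.
  by rewrite (edistC _ x0) (edistC origin x0); lra.
have := zy x wx; have := edist_triangle x0 (c n (cell_index n x0)) y.
by rewrite -/x0 (edistC _ x0) (edistC y x0); lra.
Qed.

(** Void in [S] but not in the union of [S] and the cube [Q]: the probability is at most
    that of [S] being void times [1 - expR (- lam * mu Q) <= lam * mu Q]. The cube
    need not be disjoint from [S]. *)
Let prob_up n k y : (P (ysection (up n k) y) <=
  (lam * q n k * expR (- (lam * fine (mu (shell (- mesh d n) (c n k) y)))))%:E)%E.
Proof.
pose S := shell (- mesh d n) (c n k) y.
have mS : measurable S by exact: measurable_shell.
have [r hr] := shell_bounded (- mesh d n) (c n k) y.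
have [r' hr'] := shell_bounded (mesh d n) (c n k) y.
pose M := Num.max r r'.
have Sr : S `<=` eball origin M by move=> x /hr; rewrite /eball /= le_max => ->.
have Qr : Q n k `<=` eball origin M.
  by move=> x /(@Q_sub_shell n k y)/hr'; rewrite /eball /= le_max orbC => ->.
have SQr : S `|` Q n k `<=` eball origin M by move=> x [/Sr|/Qr].
have mSQ : measurable (S `|` Q n k) by exact: measurableU.
have -> : ysection (up n k) y =
    [set w | Phi w `&` S = set0] `\` [set w | Phi w `&` (S `|` Q n k) = set0].
  apply/seteqP; split => w; rewrite /ysection /= inE /= setIUr.
    by move=> [h1 h2]; split => //; rewrite setU_eq0 => -[].
  move=> [h1 h2]; split => // h3; apply: h2; rewrite setU_eq0; by [].
rewrite measureD; last 3 first.
- exact: (measurable_void hPhi mS Sr).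
- exact: (measurable_void hPhi mSQ SQr).
- by rewrite [X in (X < _)%E](prob_void hPhi lam0 mS Sr) ltry.
rewrite setIidr; last by move=> w /=; rewrite setIUr setU_eq0 => -[].
rewrite [X in (X - _)%E](prob_void hPhi lam0 mS Sr) [X in (_ - X)%E](prob_void hPhi lam0 mSQ SQr) -EFinB lee_fin.
have Sfin : mu S \is a fin_num by exact: fin_num_shell.
have le : fine (mu (S `|` Q n k)) <= fine (mu S) + q n k.
  have le0 : (mu (S `|` Q n k) <= mu S + mu (Q n k))%E by exact: measureU2.
  have f : mu (S `|` Q n k) \is a fin_num.
    rewrite ge0_fin_numE//; apply: (le_lt_trans le0).
    by rewrite muQ -(fineK Sfin) -EFinD ltry.
  by rewrite -lee_fin EFinD (fineK Sfin) (fineK f) -muQ.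
have e1 : expR (- (lam * (fine (mu S) + q n k))) <= expR (- (lam * fine (mu (S `|` Q n k)))).
  by rewrite ler_expR lerN2 ler_pM2l.
have e2 : expR (- (lam * fine (mu S))) * (1 - lam * q n k) <= expR (- (lam * (fine (mu S) + q n k))).
  by rewrite [lam * (fine (mu S) + _)]mulrDr opprD expRD ler_pM2l ?expR_gt0//; exact: expR_ge1Dx.
move: e1 e2; rewrite mulrBr mulr1 [_ * (lam * q n k)]mulrC; lra.
Qed.

Let integral_up n k y :
  (P (ysection (up n k) y) <= \int[mu]_(x in Q n k) (lam%:E * e_shell (- mesh d n - mesh d n) y x))%E.
Proof.
pose b := lam * expR (- (lam * fine (mu (shell (- mesh d n) (c n k) y)))).
apply: le_trans (prob_up n k y) _.
have Eb : (lam * q n k * expR (- (lam * fine (mu (shell (- mesh d n) (c n k) y)))))%:E =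
    (b%:E * mu (Q n k))%E.
  by rewrite muQ -EFinM /b; congr EFin; ring.
rewrite Eb.
rewrite -integral_cst//; apply: ge0_le_integral => //.
- by move=> x _; rewrite lee_fin mulr_ge0 ?expR_ge0// ltW.
- by apply: measurable_funTS; apply: emeasurable_funM => //; exact: measurable_cst.
move=> x Qx; rewrite -EFinM lee_fin ler_pM2l// ler_expR lerN2 ler_pM2l//.
apply: fine_mu_le; [exact: measurable_shell|exact: measurable_shell|exact: fin_num_shell|].
rewrite -[X in shell X (c n k)](addrNK (mesh d n)).
by apply: shell_moved; rewrite edistC; apply: ltW; exact: edist_cell_point.
Qed.

(** ** The mean *)

Let sum_cells n h y : (\int[mu]_x (lam%:E * e_shell h y x) =
  \sum_(0 <= k <oo) \int[mu]_(x in Q n k) (lam%:E * e_shell h y x))%E.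
Proof.
rewrite -(bigcup_cell n) ge0_integral_bigcup//.
- by apply: measurable_funTS; apply: emeasurable_funM => //; exact: measurable_cst.
- by move=> x _; rewrite mule_ge0// lee_fin ?expR_ge0 ?ltW.
- exact: trivIset_cell.
Qed.

Let integral_e_shell h : (\int[mu]_y \int[mu]_x (lam%:E * e_shell h y x) =
  lam%:E * \int[mu \x mu]_p (expR (- (lam * shell_vol h p)))%:E)%E.
Proof.
rewrite -ge0_integralZl_EFin ?(ltW lam0)//; last exact: measurable_exp_shell.
pose f (p : Rvec R d * Rvec R d) : \bar R := (lam%:E * (expR (- (lam * shell_vol h p)))%:E)%E.
have mf : measurable_fun setT f.
  by apply: emeasurable_funM; [exact: measurable_cst|exact: measurable_exp_shell].
have f0 p : (0 <= f p)%E by rewrite mule_ge0// lee_fin ?expR_ge0 ?ltW.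
exact/esym/(fubini_tonelli2 f mf f0).
Qed.

Let measurable_empty : measurable [set w | Phi w = set0].
Proof.
rewrite (_ : [set w | _] = \bigcap_n [set w | Phi w `&` eball origin n%:R = set0]).
  apply: bigcap_measurable => // n _.
  exact: (measurable_void hPhi (measurable_eball _ _) (@subset_refl _ _)).
apply/seteqP; split => w /=; first by move=> E n _; rewrite /mkset E set0I.
move=> h; apply/seteqP; split => // x wx.
have : (Phi w `&` eball origin (Num.truncn (edist x origin)).+1%:R) x.
  by split => //; rewrite /eball /= ltW// truncnS_gt.
by rewrite (h _ I).
Qed.

Let prob_empty : P [set w | Phi w = set0] = 0%E.
Proof.
have mB (r : R) : measurable (eball (@origin R d) r) by exact: measurable_eball.
have sub (r : R) : [set w | Phi w = set0] `<=` [set w | Phi w `&` eball origin r = set0].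
  by move=> w E; rewrite /mkset E set0I.
have mE := measurable_empty.
apply/eqP; rewrite eq_le measure_ge0 andbT.
have k0 : 0 < kap := kap_gt0.
have le n : (P [set w | Phi w = set0] <= (expR (- (lam * (kap * n%:R ^+ d))))%:E)%E.
  have mun : fine (mu (eball origin n%:R)) = kap * n%:R ^+ d := congr1 fine (mu_eball d0 origin (ler0n R n)).
  rewrite -mun -(prob_void hPhi lam0 (mB n%:R) (@subset_refl _ _)).
  apply: le_measure; rewrite ?inE//.
  exact: (measurable_void hPhi (mB _) (@subset_refl _ _)).
apply/lee_addgt0Pr => e e0; rewrite add0e.
have lk : 0 < lam * kap by rewrite mulr_gt0.
pose N := (Num.truncn (e^-1 / (lam * kap))).+1.
apply: le_trans (le N) _; rewrite lee_fin.
have N1 : 1 <= N%:R :> R by rewrite ler1n.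
have hN : e^-1 < lam * kap * N%:R by rewrite mulrC -ltr_pdivrMr// truncnS_gt.
have hNd : lam * kap * N%:R <= lam * kap * N%:R ^+ d.
  by rewrite ler_pM2l//; apply: ler_eXnr.
rewrite mulrA expRN -[leRHS]invrK lef_pV2 ?posrE ?invr_gt0 ?expR_gt0//.
apply: (le_trans (ltW hN)); apply: (le_trans hNd).
by apply: le_trans (expR_ge1Dx _); rewrite lerDr.
Qed.

Let lower n : (lam%:E * \int[mu \x mu]_p (expR (- (lam * shell_vol (mesh d n + mesh d n) p)))%:E <=
  \int[P]_w mu (zero_cell (Phi w)))%E.
Proof.
pose L := \bigcup_k low n k.
have mL : measurable L by apply: bigcup_measurable => k _; exact: measurable_low.
apply: (@le_trans _ _ (\int[P]_w mu (xsection L w))%E); last first.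
  apply: ge0_le_integralT => // w; apply: le_measure; rewrite ?inE.
  - exact: measurable_xsection.
  - exact: (measurable_voronoi_cell hPhi).
  - by move=> y; rewrite /xsection /= inE => -[k _]; exact: low_zero_cell.
rewrite -integral_e_shell (integral_sections P mu mL); apply: ge0_le_integral => //.
- by move=> y _; apply: integral_ge0 => x _; rewrite mule_ge0// lee_fin ?expR_ge0 ?ltW.
- exact: measurable_fun_ysection.
move=> y _; rewrite (sum_cells n).
have -> : ysection L y = \bigcup_k ysection (low n k) y.
  by apply/seteqP; split => w; rewrite /ysection /= inE => -[k _ h]; exists k => //=; rewrite ?inE// -inE.
rewrite measure_semi_bigcup; last 3 first.
- by move=> k; exact: measurable_ysection.
- apply/trivIsetP => i j _ _ ij; apply/seteqP; split => // w []; rewrite /ysection /= !inE => h1 h2.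
  have /trivIsetP/(_ i j I I ij) E := @trivIset_low n.
  by have : (low n i `&` low n j) (w, y) by []; rewrite E.
- by apply: bigcup_measurable => k _; exact: measurable_ysection.
apply: lee_nneseries => k _; last exact: integral_low.
by move=> _; apply: integral_ge0 => x _; rewrite mule_ge0// lee_fin ?expR_ge0 ?ltW.
Qed.

Let upper n : (\int[P]_w mu (zero_cell (Phi w)) <=
  lam%:E * \int[mu \x mu]_p (expR (- (lam * shell_vol (- mesh d n - mesh d n) p)))%:E)%E.
Proof.
pose N : set T := [set w | Phi w = set0].
have mN : measurable N by exact: measurable_empty.
pose L := \bigcup_k up n k.
have mL : measurable L by apply: bigcup_measurable => k _; exact: measurable_up.
pose L' := L `|` (N `*` [set: Rvec R d]).
have mL' : measurable L' by apply: measurableU => //; exact: measurableX.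
apply: (@le_trans _ _ (\int[P]_w mu (xsection L' w))%E).
  apply: ge0_le_integralT => // w; apply: le_measure; rewrite ?inE.
  - exact: (measurable_voronoi_cell hPhi).
  - exact: measurable_xsection.
  - move=> y zy; rewrite /xsection /= inE; have [w0|w0] := pselect (Phi w = set0); first by right.
    left; have [|k hk] := zero_cell_up n _ zy; last by exists k.
    by apply/set0P/eqP.
rewrite -integral_e_shell (integral_sections P mu mL'); apply: ge0_le_integral => //.
- exact: measurable_fun_ysection.
move=> y _; rewrite (sum_cells n).
have sub : ysection L' y `<=` (\bigcup_k ysection (up n k) y) `|` N.
  move=> w; rewrite /ysection /= inE => -[[k _ h]|[]]; last by right.
  by left; exists k => //=; rewrite inE.
have mU : measurable (\bigcup_k ysection (up n k) y).
  by apply: bigcup_measurable => k _; exact: measurable_ysection.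
apply: (@le_trans _ _ (P ((\bigcup_k ysection (up n k) y) `|` N))).
  by apply: le_measure; rewrite ?inE//; [exact: measurable_ysection|exact: measurableU].
apply: (@le_trans _ _ (P (\bigcup_k ysection (up n k) y) + P N)%E); first exact: measureU2.
rewrite prob_empty adde0.
apply: (@le_trans _ _ (\sum_(0 <= k <oo) P (ysection (up n k) y))%E).
  by apply: measure_sigma_subadditive => // k; exact: measurable_ysection.
by apply: lee_nneseries => k _ //; exact: integral_up.
Qed.

(** In the limit of fine grids both bounds become the integral over [x] and [y] of the
    intensity times the probability that no nucleus is closer than [x] to the origin
    or to [y]. *)
Lemma mean_mu_zero_cell :
  (\int[P]_w mu (zero_cell (Phi w)) = (lam * mean_Z2sq d lam)%:E)%E.
Proof.
have m2 : (mesh d n + mesh d n : R) @[n --> \oo] --> 0.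
  by rewrite -(addr0 (0 : R)); apply: cvgD; exact: cvg_mesh.
have m2N : (- mesh d n - mesh d n : R) @[n --> \oo] --> 0.
  by rewrite -(addr0 (0 : R)) -oppr0; apply: cvgD; apply: cvgN; exact: cvg_mesh.
have hm n : mesh d n <= d.+1%:R :> R.
  by rewrite /mesh ler_pdivrMr// ler_peMr// ler1n.
have fin : (\int[mu \x mu]_p (expR (- (lam * two_balls_vol p)))%:E)%E \is a fin_num.
  by apply: integrable_fin_num => //; exact: integrable_exp_two_balls.
have -> : (lam * mean_Z2sq d lam)%:E = (lam%:E * \int[mu \x mu]_p (expR (- (lam * shell_vol 0 p)))%:E)%E.
  by rewrite integral_exp_shell0// -(fineK fin).
have c1 := cvg_integral_exp_shell d0 lam0 m2 (ler0n R (d.+1 + d.+1)).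
have c2 := cvg_integral_exp_shell d0 lam0 m2N (ler0n R (d.+1 + d.+1)).
apply/eqP; rewrite eq_le; apply/andP; split.
  have h n : - (d.+1 + d.+1)%:R <= - mesh d n - mesh d n :> R.
    by rewrite natrD; have := hm n; lra.
  apply: (cvge_to_ge (cvgeZl _ (c2 h))) => //; apply: nearW => n; exact: upper.
have h n : - (d.+1 + d.+1)%:R <= mesh d n + mesh d n :> R.
  apply: (@le_trans _ _ 0); first by rewrite oppr_le0.
  by rewrite addr_ge0// ltW// mesh_gt0.
apply: (cvge_to_le (cvgeZl _ (c1 h))) => //; apply: nearW => n; exact: lower.
Qed.

End zero_cell_mean.

(** * The correction factor *)

Section taylor_approximation.
Context {disp : measure_display} {T : measurableType disp} {R : realType}.
Context {P : probability T R} {d : nat} {lam : R} {Phi : T -> set (Rvec R d)}.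
Hypothesis hPhi : poisson_process P lam Phi.
Hypotheses (d0 : (0 < d)%N) (lam0 : 0 < lam).
Local Notation mu := (lebesgue_measure_vec R d).
Local Notation kap := (@unit_ball_volume R d).

Let mu_eball0 : mu (eball origin 0) = 0%E.
Proof. by rewrite mu_eball// expr0n gtn_eqF// mulr0. Qed.

Let mean_Z1_0 : mean_Z1 d lam 0 = 0.
Proof.
rewrite /mean_Z1 /Rintegral; set f : Rvec R d -> \bar R := fun=> _.
have mf : measurable_fun setT f.
  apply/measurable_EFinP; have := @measurable_exp_norm R d (lam * kap).
  by congr measurable_fun; apply/funext => y; rewrite mulrA.
by rewrite (null_set_integral (measurable_eball _ _) (measurable_funTS mf) mu_eball0).
Qed.

Let mean_Z1Z2_0 : mean_Z1Z2 d lam 0 = 0.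
Proof.
rewrite /mean_Z1Z2 /Rintegral.
pose f (p : Rvec R d * Rvec R d) : \bar R := (expR (- (lam * two_balls_vol p)))%:E.
have mf : measurable_fun setT f.
  apply/measurable_EFinP; apply: measurableT_comp => //; apply: measurableT_comp => //.
  by apply: measurable_funM; [exact: measurable_cst|exact: measurable_two_balls_vol].
have f0 p : (0 <= f p)%E by rewrite lee_fin expR_ge0.
rewrite (ge0_integral_prodX mu mu (measurable_eball origin 0) mf f0).
by rewrite (null_set_integral (measurable_eball _ _) _ mu_eball0)//;
  apply: measurable_funTS; exact: (measurable_integral_pair mu mf f0).
Qed.

(** The limit of [G r / r ^+ d] at [0], times [d!]. *)
Lemma is_derivn_within_G : is_derivn_within `[0, +oo[ d (G P Phi) 0
  (d`!%:R * (kap * lam ^+ 3 * mean_Z2sq d lam)).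
Proof.
have [f1 [E1 s1]] := euler_smooth_mean_Z1 d0 lam0.
have [f2 [E2 s2]] := euler_smooth_mean_Z1Z2 d0 lam0.
pose A := 2 * lam + lam ^+ 3 * (mean_Z2sq d lam - lam^-1 ^+ 2).
have -> : kap * lam ^+ 3 * mean_Z2sq d lam = A * kap + - lam ^+ 2 * (kap / lam).
  by rewrite /A; field; rewrite gt_eqF.
apply: (@is_derivn_within_euler_smooth _ d _ (fun r => A * f1 r + - lam ^+ 2 * f2 r)) => //.
- by move=> r r0; rewrite (GE hPhi d0 lam0 (ltW r0)) E1// E2// /A; ring.
- by rewrite (GE hPhi d0 lam0 (lexx 0)) mean_Z1_0 mean_Z1Z2_0 !mul0r subrr.
- by apply: euler_smoothD; apply: euler_smoothZ; [exact: s1|exact: s2].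
Qed.

End taylor_approximation.

Lemma is_derivn_within_expR_pow (R : realType) (d : nat) (c : R) : (0 < d)%N ->
  is_derivn_within `[0, +oo[ d (fun r => 1 - expR (- (c * r ^+ d))) 0 (d`!%:R * c).
Proof.
move=> d0.
apply: (@is_derivn_within_euler_smooth _ d _ (fun r => (1 - expR (- (c * r ^+ d))) / r ^+ d)) => //.
- by move=> r r0; rewrite [RHS]mulrC divfK// expf_neq0// gt_eqF.
- by rewrite expr0n gtn_eqF// mulr0 oppr0 expR0 subrr.
- exact: (euler_smooth_pow d0 (euler_smooth_expRm1 d c)).
Qed.

Theorem corollary4 (disp : measure_display) (T : measurableType disp)
    (R : realType) (P : probability T R) (d : nat) (hd : (0 < d)%N)
    (lam : R) (hlam : 0 < lam) (Phi : T -> set (Rvec R d))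
    (hPhi : poisson_process P lam Phi) (rho : R) :
  is_correction_factor P lam Phi rho <->
  (rho%:E = (\int[P]_w lebesgue_measure_vec R d (zero_cell (Phi w)))
            / (\int[P]_w lebesgue_measure_vec R d (typical_cell (Phi w))))%E.
Proof.
rewrite (mean_mu_zero_cell hPhi hd hlam) (mean_mu_typical hPhi hd hlam).
have lam_neq0 : lam != 0 by rewrite gt_eqF.
rewrite inver invr_eq0 (negPf lam_neq0) invrK -EFinM.
have k0 : 0 < kappa R d by rewrite -kapE kap_gt0.
have DF := is_derivn_within_expR_pow (rho * lam * kappa R d) hd.
have DG := is_derivn_within_G hPhi hd hlam; rewrite kapE in DG.
have E : (d`!%:R * (rho * lam * kappa R d) =
          d`!%:R * (kappa R d * lam ^+ 3 * mean_Z2sq d lam)) <->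
    rho = lam * mean_Z2sq d lam * lam.
  have dk0 : d`!%:R * lam * kappa R d != 0.
    rewrite gt_eqF//; apply: mulr_gt0 k0; apply: mulr_gt0 hlam.
    by rewrite ltr0n fact_gt0.
  split=> [h|->]; last by ring.
  apply: (mulfI dk0); transitivity (d`!%:R * (rho * lam * kappa R d)); first by ring.
  by rewrite h; ring.
split=> [[l [DF' DG']]|[rhoE]].
  congr EFin; apply/E.
  by rewrite (is_derivn_within_uniq (lexx 0) DF DF') (is_derivn_within_uniq (lexx 0) DG DG').
exists (d`!%:R * (rho * lam * kappa R d)); split => //.
by rewrite (E.2 rhoE).
Qed.
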